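(* There is a constant $C_0>0$ such that for every $u\in H^2(S^1)$ with $u>0$ satisfying $$\int_0^{2\pi}\frac{\cos^3(\theta+\alpha)}{u^{5/3}(\theta)}\,d\theta=0\quad\text{for all }\alpha\in\mathbb{R},$$ one has $$\int_0^{2\pi}(u_{\theta\theta}^2-10u_\theta^2+9u^2)\,d\theta\ \left(\int_0^{2\pi}u^{-2/3}(\theta)\,d\theta\right)^3\ \ge\ C_0>0.$$ Moreover, if $u_0$ is an extremal function (that is, $u_0$ attains the infimum of the left-hand side among all $u\in H^2(S^1)$ with $u>0$ satisfying $\int_0^{2\pi}\cos^3(\theta+\alpha)\,u^{-5/3}(\theta)\,d\theta=0$ for all $\alpha\in\mathbb{R}$), then the symmetric $Q$-curvature of the metric $u_0^{-4/3}g_s$ is a constant.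
   Context: $S^1$ is the unit circle, parametrized by the angle $\theta\in[0,2\pi]$, with standard metric $g_s=d\theta\otimes d\theta$; functions on $S^1$ are identified with $2\pi$-periodic functions of $\theta$, and subscripts $\theta$ denote derivatives in $\theta$. $H^2(S^1)$ is the usual Sobolev space; $u>0$ means positive everywhere. For a metric $g=v^{-4/3}g_s$ on $S^1$ with $v>0$, the symmetric $Q$-curvature is $$Q^A_g=\tfrac19\,v^{5/3}\big(v_{\theta\theta\theta\theta}+10v_{\theta\theta}+9v\big),$$ where, for $v$ only known to be in $H^2(S^1)$, the fourth derivative is a priori understood in the sense of distributions. *)

(* Defs.v *)
From HB Require Import structures.
From mathcomp Require Import all_boot all_order all_algebra.
From mathcomp Require Import all_classical all_reals all_analysis.

Set Implicit Arguments.
Unset Strict Implicit.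
Unset Printing Implicit Defensive.

Import Order.TTheory GRing.Theory Num.Theory.
Import numFieldNormedType.Exports.

Local Open Scope classical_set_scope.
Local Open Scope ring_scope.

Section SymmetricQCurvature.
Variable R : realType.
Implicit Types (u v f g w q phi : R -> R) (k : nat).

Local Notation mu := (@lebesgue_measure R).

Definition circle : set R := `[0, 2 * pi]%classic.

(* Functions on S^1 are identified with 2 pi-periodic functions of the angle. *)
Definition periodic2pi f := periodic f (2 * pi).

Definition test_function phi :=
  periodic2pi phi /\
  forall k (x : R), derivable (derive1n k phi : R -> R) x 1.

(* g represents the k-th derivative of f in the sense of distributions on
   S^1. *)
Definition is_weak_derivative k f g :=
  [/\ periodic2pi g,
      mu.-integrable circle (EFin \o g) &
      forall phi, test_function phi ->
        \int[mu]_(x in circle) (f x * derive1n k phi x) =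
        (-1) ^+ k * \int[mu]_(x in circle) (g x * phi x)].

(* A choice of k-th weak derivative; it is unique up to a null set, and is
   the zero function when there is none. *)
Definition weak_derivative k f : R -> R :=
  xget (cst 0) [set g | is_weak_derivative k f g].

Definition square_integrable g := (g \_ circle) \in Lfun mu 2%:E.

(* A class in H^2(S^1) is identified with its continuous representative,
   which exists by Sobolev embedding; this is what gives u > 0 a pointwise
   meaning. *)
Definition sobolevH2 u :=
  [/\ periodic2pi u, continuous u &
      forall k, (0 < k <= 2)%N ->
        exists2 g, is_weak_derivative k u g & square_integrable g].

Definition cos3_orthogonal u := forall alpha : R,
  \int[mu]_(x in circle) (cos (x + alpha) ^+ 3 / (u x `^ (5 / 3))) = 0.

Definition admissible u :=
  [/\ sobolevH2 u, (forall x, 0 < u x) & cos3_orthogonal u].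

Definition functional u : R :=
  (\int[mu]_(x in circle)
     (weak_derivative 2 u x ^+ 2 - 10 * weak_derivative 1 u x ^+ 2
      + 9 * u x ^+ 2)) *
  (\int[mu]_(x in circle) (u x `^ (- (2 / 3)))) ^+ 3.

Definition extremal u :=
  admissible u /\ forall v, admissible v -> functional u <= functional v.

(* The symmetric Q-curvature of the metric v^(-4/3) g_s, a priori the
   distribution v^(5/3) (D^4 v + 10 D^2 v + 9 v) / 9, is the function q.
   Since v^(5/3) > 0 can be divided out, this forces the distribution D^4 v
   to be a function w. *)
Definition symmetric_Qcurvature v q :=
  exists2 w, is_weak_derivative 4 v w &
    {ae mu, forall x, circle x ->
      q x = 9^-1 * v x `^ (5 / 3)
            * (w x + 10 * weak_derivative 2 v x + 9 * v x)}.

End SymmetricQCurvature.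

(* Main.v *)
Require Import Defs.
From mathcomp Require Import all_boot all_order all_algebra.
From mathcomp Require Import all_classical all_reals all_analysis.
From mathcomp Require Import measurable_realfun ring lra.

(* Write E(u) for the energy and P = D^4 + 10 D^2 + 9 = (D^2 + 1)(D^2 + 9), whose
   kernel is spanned by the cubic forms in cos and sin. On a half circle, with
   t = - cot x and w = sin^3 x * f(t), the energy of a function w vanishing to
   first order at both ends is the integral of f''(t)^2.

   Let u_e(x) = (u(x) + u(x + pi)) / 2, let c be a minimum point of u_e, and
   m = u_e(c). Subtracting from u the function m |cos(x - c)|^3 plus a cubic form
   leaves a w vanishing to first order at c and c + pi; since P |cos|^3 = 12 delta
   at the zeros of cos, E(u) = E(w) + 48 m u_e(c + pi / 2). Hence A^2 := E(u)
   controls m^2, m u_e(c + pi / 2) and the integral of f''^2, so that u <= 6 m on an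
   interval of length (m / A)^(2/3); therefore E(u) (int u^(-2/3))^3 >= 1/36.

   If u is extremal, then u_e is admissible, E(u_e) <= E(u), and the integral of
   u_e^(-2/3) is smaller than that of u unless u = u_e. So u is pi-periodic, every
   pi-periodic perturbation is admissible (the constraint holds by symmetry), and
   the Euler-Lagrange equation P u = (E / I) u^(-5/3) carries no multiplier. *)

Import Order.TTheory GRing.Theory Num.Theory.
Import numFieldNormedType.Exports.

Set Implicit Arguments.
Unset Strict Implicit.
Unset Printing Implicit Defensive.

Local Open Scope classical_set_scope.
Local Open Scope ring_scope.

(** The energy is indefinite: frequency n carries the factor (n^2 - 1)(n^2 - 9), which is -15 at n =
    2 and nonnegative for odd n. It cannot be bounded below mode by mode, so positivity is obtained
    from clamping. Clamping at both c and c + pi is four conditions, and cubic forms change sign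
    under the half turn: they remove only data whose values and slopes at the two points sum to
    zero. Subtracting m |cos|^3 arranges this for the values, and the choice of a critical point of
    u_e for the slopes; after that A cos + B sin suffices. Minimality of c gives u_e(c + pi / 2) >=
    m, hence E(u) >= 48 m^2 > 0.

    The variable - cot x is a projective chart of the circle. In it cubic forms become polynomials
    of degree at most 3 and P becomes the fourth derivative up to a power of sin, which is why the
    energy of a clamped function is the integral of a square. The circle is cut into quarters
    because |cos|^3 is smooth on each of them.

    The sign for odd frequencies is the reason for E(u_e) <= E(u): the part of u that is removed has
    odd frequencies only. *)

Section RealIntegrals.
Variable R : realType.
Local Notation mu := (@lebesgue_measure R).
Implicit Types (a b c x y : R) (f g h F G : R -> R) (D : set R).

(** * Lebesgue integrals over segments *)

Definition intg a b f : Prop := mu.-integrable `[a, b] (EFin \o f).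
Definition itg a b f := \int[mu]_(x in `[a, b]) f x.

Lemma intgD a b f g : intg a b f -> intg a b g ->
  intg a b (fun x => f x + g x).
Proof.
move=> fi gi.
by apply: eq_integrable (integrableD _ fi gi).
Qed.

Lemma intgZ a b r f : intg a b f -> intg a b (fun x => r * f x).
Proof.
move=> fi.
by apply: eq_integrable (integrableZl _ r fi).
Qed.

Lemma eq_intg a b f g : (forall x, a <= x <= b -> f x = g x) ->
  intg a b f -> intg a b g.
Proof.
move=> fg; apply: eq_integrable => //= x; rewrite inE/= in_itv/= => xab.
by rewrite fg.
Qed.

Lemma intgN a b f : intg a b f -> intg a b (fun x => - f x).
Proof. by move=> /(@intgZ _ _ (-1)); apply: eq_intg => x _; rewrite mulN1r. Qed.

Lemma intgB a b f g : intg a b f -> intg a b g ->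
  intg a b (fun x => f x - g x).
Proof. by move=> fi /intgN; exact: intgD. Qed.

Lemma intg_norm a b f : intg a b f -> intg a b (fun x => `|f x|).
Proof. by move=> fi; exact: integrable_norm. Qed.

Lemma intg_sub a b c d f : a <= c -> d <= b -> intg a b f -> intg c d f.
Proof.
move=> ac db; apply: integrableS => //.
by apply: subset_itv; rewrite bnd_simp.
Qed.

Lemma intg_cst a b r : intg a b (fun=> r).
Proof.
apply: continuous_compact_integrable; first exact: segment_compact.
by move=> x; exact: cvg_cst.
Qed.

Lemma intg_cont a b f : {within `[a, b], continuous f} -> intg a b f.
Proof.
by move=> cf; apply: continuous_compact_integrable; [exact: segment_compact|].
Qed.

Lemma intg_measurable a b f : intg a b f -> measurable_fun `[a, b] f.
Proof. by move=> /measurable_int/measurable_EFinP. Qed.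

Lemma intgM a b f g : {within `[a, b], continuous f} -> intg a b g ->
  intg a b (fun x => f x * g x).
Proof.
move=> cf gi; have := @integrableMr _ _ _ mu `[a, b] _ f (EFin \o g).
have mf : measurable_fun `[a, b] f by apply: intg_measurable; exact: intg_cont.
have bf : [bounded f x | x in `[a, b]].
  have /compact_bounded[M [_ mrt]] := continuous_compact cf (@segment_compact _ a b).
  by exists M; split; rewrite ?num_real // => ? ? ? ?; exact: mrt.
move=> /(_ (measurable_itv _) mf bf gi).
by apply: eq_integrable => // x _; rewrite /= EFinM.
Qed.

Lemma itgD a b f g : intg a b f -> intg a b g ->
  itg a b (fun x => f x + g x) = itg a b f + itg a b g.
Proof. by move=> fi gi; rewrite /itg RintegralD. Qed.

Lemma itgB a b f g : intg a b f -> intg a b g ->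
  itg a b (fun x => f x - g x) = itg a b f - itg a b g.
Proof. by move=> fi gi; rewrite /itg RintegralB. Qed.

Lemma itgZ a b r f : intg a b f -> itg a b (fun x => r * f x) = r * itg a b f.
Proof. by move=> fi; rewrite /itg RintegralZl. Qed.

Lemma eq_itg a b f g : (forall x, a <= x <= b -> f x = g x) ->
  itg a b f = itg a b g.
Proof.
by move=> fg; apply: eq_Rintegral => x; rewrite inE/= in_itv/=; exact: fg.
Qed.

Lemma itgN a b f : intg a b f -> itg a b (fun x => - f x) = - itg a b f.
Proof.
move=> fi; rewrite -mulN1r -itgZ//.
by apply: eq_itg => x _; rewrite mulN1r.
Qed.

Lemma le_itg a b f g : intg a b f -> intg a b g ->
  (forall x, a <= x <= b -> f x <= g x) -> itg a b f <= itg a b g.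
Proof.
by move=> fi gi fg; apply: le_Rintegral => // x; rewrite /= in_itv/=; exact: fg.
Qed.

Lemma itg_ge0 a b f : (forall x, a <= x <= b -> 0 <= f x) -> 0 <= itg a b f.
Proof. by move=> f0; apply: Rintegral_ge0 => x; rewrite /= in_itv/=; exact: f0. Qed.

Lemma itg_cst a b r : a <= b -> itg a b (fun=> r) = r * (b - a).
Proof.
move=> ab; rewrite /itg Rintegral_cst//= lebesgue_measure_itv/= lte_fin.
case: ltP => //= ba; have -> : a = b by apply/eqP; rewrite eq_le ab.
by rewrite subrr.
Qed.

Lemma itg_norm a b f : intg a b f -> `|itg a b f| <= itg a b (fun x => `|f x|).
Proof. by move=> fi; exact: le_normr_Rintegral. Qed.

Lemma itg_xx a f : itg a a f = 0.
Proof. by rewrite /itg set_itv1 Rintegral_set1. Qed.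

Lemma itg_cat a c b f : a <= c -> c <= b -> intg a b f ->
  itg a b f = itg a c f + itg c b f.
Proof.
move=> ac cb fi; apply/eqP; rewrite addrC -subr_eq; apply/eqP.
rewrite /itg Rintegral_itvB ?bnd_simp// Rintegral_itv_obnd_cbnd//.
by apply: integrableS fi => //; apply: subset_itv; rewrite bnd_simp.
Qed.

Lemma intg_cat a c b f : a <= c -> c <= b -> intg a c f -> intg c b f ->
  intg a b f.
Proof.
move=> ac cb f1 f2.
have E : [set` `[a, b]] = [set` `[a, c]] `|` [set` `[c, b]].
  apply/seteqP; split=> x /=; rewrite !in_itv/=.
    move=> /andP[ax xb]; case: (leP x c) => xc; [left|right]; rewrite ?ax//=.
    by rewrite (ltW xc).
  case=> /andP[h1 h2]; rewrite ?h1 ?h2 ?andbT//=; [exact: le_trans h2 _|].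
  exact: le_trans h1.
rewrite /intg E.
move/integrableP: (f1) => [m1 i1]; move/integrableP: (f2) => [m2 i2].
apply/integrableP; split; first by apply/measurable_funU.
apply: le_lt_trans (_ : _ <= (\int[mu]_(x in `[a, c]) `|(EFin \o f) x| +
  \int[mu]_(x in `[c, b]) `|(EFin \o f) x|)%E)%E _; last by rewrite lte_add_pinfty.
have -> : [set` `[a, c]] `|` [set` `[c, b]] = [set` `[a, c]] `|` [set` `]c, b]].
  apply/seteqP; split=> x /=; rewrite !in_itv/=.
    case=> /andP[h1 h2]; first by left; rewrite h1.
    by case: (leP x c) => xc; [left; rewrite (le_trans ac h1)|right].
  by case=> /andP[h1 h2]; [left; rewrite h1|right; rewrite (ltW h1)].
rewrite ge0_integral_setU//=; last 2 first.
- have m3 : measurable_fun [set` `]c, b]] (EFin \o f).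
    apply: (@measurable_funS _ _ _ _ [set` `[c, b]]) => //.
    by apply: subset_itv; rewrite bnd_simp.
  have : measurable_fun ([set` `[a, c]] `|` [set` `]c, b]]) (EFin \o f).
    by apply/measurable_funU.
  by move=> /measurable_EFinP m4; apply/measurable_EFinP; exact: measurableT_comp.
- apply/disj_setPS => y [/=]; rewrite 2!in_itv/= => /andP[_ yx] /andP[].
  by rewrite ltNge yx.
rewrite leeD2l//; apply: ge0_subset_integral => //=.
  by apply/measurable_EFinP; apply: measurableT_comp => //; apply/measurable_EFinP.
by apply: subset_itv; rewrite bnd_simp.
Qed.

Lemma small_itg a b f e : 0 < e -> intg a b f ->
  exists2 d, 0 < d & forall x y, a <= x -> x <= y -> y <= b -> y - x < d ->
    itg x y (fun t => `|f t|) < e.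
Proof.
move=> e0 fi.
have fi' : mu.-integrable setT (EFin \o (f \_ `[a, b])).
  by rewrite -restrict_EFin; apply/integrable_restrict => //=; rewrite setTI.
have [d [d0 dP]] := integral_normr_continuous fi' e0.
exists d => // x y ax xy yb yxd.
have xyd : (mu [set` `[x, y]] < d%:E)%E.
  rewrite lebesgue_measure_itv/=.
  by case: ifPn => // _; rewrite -EFinB lte_fin.
have := dP _ (measurable_itv _) xyd; congr (_ < _).
apply: eq_Rintegral => t; rewrite inE/= in_itv/= => /andP[xt ty].
by rewrite patchE mem_set//= in_itv/= (le_trans ax xt)/= (le_trans ty).
Qed.

End RealIntegrals.

(** * Absolutely continuous functions and the product rule *)

Section Primitives.
Variable R : realType.
Local Notation mu := (@lebesgue_measure R).
Implicit Types (a b c x y : R) (f g h F G : R -> R).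

(** Absolute continuity in integral form, with [f] any integrable representative of the derivative.
    Second derivatives in H^2 are no better than that, and every integration by parts below is an
    instance of the product rule for this relation. *)
Definition prim a b F f :=
  intg a b f /\ forall x, a <= x <= b -> F x = F a + itg a x f.

Lemma prim_itg a b F f : a <= b -> prim a b F f -> itg a b f = F b - F a.
Proof.
by move=> ab [_ /(_ b)]; rewrite ab lexx => -> //; rewrite addrC addKr.
Qed.

Lemma prim_diff a b F f x y : prim a b F f -> a <= x -> x <= y -> y <= b ->
  F y - F x = itg x y f.
Proof.
move=> [fi PF] ax xy yb.
have ay := le_trans ax xy; have xb := le_trans xy yb.
rewrite (PF y) ?ay// (PF x) ?ax// (@itg_cat _ a x y)//; first by ring.
exact: intg_sub fi.
Qed.

Lemma prim_sub a b c d F f : a <= c -> d <= b -> prim a b F f -> prim c d F f.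
Proof.
move=> ac db PF; split; first exact: intg_sub PF.1.
move=> x /andP[cx xd]; rewrite -(prim_diff PF)//; first by ring.
exact: le_trans db.
Qed.

Lemma prim_cat a c b F f : a <= c -> c <= b -> prim a c F f -> prim c b F f ->
  prim a b F f.
Proof.
move=> ac cb P1 P2; have fi := intg_cat ac cb P1.1 P2.1.
split=> // x /andP[ax xb]; case: (leP x c) => xc.
  by apply: P1.2; rewrite ax.
rewrite P2.2 ?(ltW xc)// (P1.2 c) ?ac ?lexx//.
rewrite (@itg_cat _ a c x f) ?(ltW xc)//; first by ring.
exact: intg_sub fi.
Qed.

Lemma eq_prim a b F f G g : (forall x, a <= x <= b -> F x = G x) ->
  (forall x, a <= x <= b -> f x = g x) -> prim a b F f -> prim a b G g.
Proof.
move=> FG fg [fi PF]; split; first exact: eq_intg fi.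
move=> x xab; have /andP[ax xb] := xab.
rewrite -!FG ?lexx ?(le_trans ax xb)// PF//; congr (_ + _).
by apply: eq_itg => t /andP[at_ tx]; rewrite fg// at_ (le_trans tx).
Qed.

Lemma prim_cst a b c : prim a b (fun=> c) (fun=> 0).
Proof.
split; first exact: intg_cst.
by move=> x /andP[ax _]; rewrite itg_cst// mul0r addr0.
Qed.

Lemma primD a b F f G g : prim a b F f -> prim a b G g ->
  prim a b (fun x => F x + G x) (fun x => f x + g x).
Proof.
move=> [fi PF] [gi PG]; split; first exact: intgD.
move=> x xab; have /andP[ax xb] := xab.
rewrite PF// PG// itgD ?(intg_sub _ _ fi) ?(intg_sub _ _ gi)//; first by ring.
  exact: intg_sub fi.
exact: intg_sub gi.
Qed.

Lemma primZ a b c F f : prim a b F f ->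
  prim a b (fun x => c * F x) (fun x => c * f x).
Proof.
move=> [fi PF]; split; first exact: intgZ.
move=> x xab; have /andP[ax xb] := xab.
rewrite PF// itgZ; first by ring.
exact: intg_sub fi.
Qed.

Lemma primN a b F f : prim a b F f -> prim a b (fun x => - F x) (fun x => - f x).
Proof.
move=> /(primZ (-1)); apply: eq_prim => x _; exact: mulN1r.
Qed.

Lemma primB a b F f G g : prim a b F f -> prim a b G g ->
  prim a b (fun x => F x - G x) (fun x => f x - g x).
Proof. by move=> PF /primN; exact: primD. Qed.

Lemma prim_cont a b F f : a <= b -> prim a b F f ->
  {within `[a, b], continuous F}.
Proof.
move=> ab [fi PF].
have cI := parameterized_integral_continuous ab fi.
apply: (@subspace_eq_continuous _ _ _ (fun x => F a + itg a x f)).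
  by move=> x; rewrite inE/= in_itv/= => /PF E; exact: esym E.
by move=> x; apply: cvgD; [exact: cvg_cst|exact: cI].
Qed.

Lemma prim_small a b F f e : 0 < e -> prim a b F f ->
  exists2 d, 0 < d & forall x y, a <= x -> x <= y -> y <= b -> y - x < d ->
    `|F y - F x| <= e.
Proof.
move=> e0 PF; have [d d0 dP] := small_itg e0 PF.1.
exists d => // x y ax xy yb yxd.
rewrite (prim_diff PF)// (le_trans (itg_norm _))//; last exact/ltW/dP.
exact: intg_sub PF.1.
Qed.

(* The defect [FG(y) - FG(x) - \int_x^y (f G + F g)] is at most
   [e * \int_x^y (|f| + |g|)] on short intervals, hence on all. *)
Lemma primM a b F f G g : a <= b -> prim a b F f -> prim a b G g ->
  prim a b (fun x => F x * G x) (fun x => f x * G x + F x * g x).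
Proof.
move=> ab PF PG.
have cF := prim_cont ab PF; have cG := prim_cont ab PG.
have fGi : intg a b (fun x => f x * G x).
  by apply: eq_intg (intgM cG PF.1) => x _; rewrite mulrC.
have Fgi : intg a b (fun x => F x * g x) by exact: intgM cF PG.1.
pose h x := f x * G x + F x * g x.
have hi : intg a b h by exact: intgD.
pose k x := `|f x| + `|g x|.
have ki : intg a b k by apply: intgD; apply: intg_norm; [exact: PF.1|exact: PG.1].
have short e : 0 < e -> exists2 d, 0 < d & forall x y, a <= x -> x <= y ->
    y <= b -> y - x < d ->
    `|F y * G y - F x * G x - itg x y h| <= e * itg x y k.
  move=> e0.
  have [d1 d10 H1] := prim_small e0 PF.
  have [d2 d20 H2] := prim_small e0 PG.
  exists (Num.min d1 d2); first by rewrite lt_min d10.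
  move=> x y ax xy yb; rewrite lt_min => /andP[yd1 yd2].
  have S u (ui : intg a b u) : intg x y u by exact: intg_sub ui.
  have E : F y * G y - F x * G x - itg x y h =
      itg x y (fun t => f t * (G x - G t) + (F y - F t) * g t).
    have -> : F y * G y - F x * G x = G x * itg x y f + F y * itg x y g.
      by rewrite -(prim_diff PF)// -(prim_diff PG)//; ring.
    have fi' := S _ PF.1; have gi' := S _ PG.1; have hi' := S _ hi.
    rewrite -(itgZ (G x) fi') -(itgZ (F y) gi') -itgD; [|exact: intgZ..].
    rewrite -itgB//; last by apply: intgD; exact: intgZ.
    by apply: eq_itg => t _; rewrite /h; ring.
  rewrite E.
  have I1 : intg x y (fun t => f t * (G x - G t) + (F y - F t) * g t).
    apply: (@eq_intg _ _ _ (fun t => (G x * f t + F y * g t) - h t)).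
      by move=> t _; rewrite /h; ring.
    apply: intgB; last exact: S.
    by apply: intgD; apply/intgZ/S; [exact: PF.1|exact: PG.1].
  have ki' := S _ ki.
  rewrite (le_trans (itg_norm I1))// -(itgZ e ki').
  apply: le_itg; [exact: intg_norm|exact: intgZ|].
  move=> t /andP[xt ty]; have -> : e * k t = e * `|f t| + e * `|g t| by rewrite /k mulrDr.
  rewrite (le_trans (ler_normD _ _))// lerD//.
    rewrite normrM mulrC ler_wpM2r// distrC; apply: H2 => //.
      exact: le_trans yb.
    by apply: le_lt_trans yd2; rewrite lerB.
  rewrite normrM ler_wpM2r//; apply: H1 => //.
    exact: le_trans xt.
  by apply: le_lt_trans yd1; rewrite lerB.
have long e : 0 < e -> forall x y, a <= x -> x <= y -> y <= b ->
    `|F y * G y - F x * G x - itg x y h| <= e * itg x y k.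
  move=> e0; have [d d0 dP] := short e e0.
  have d20 : 0 < d / 2 by rewrite divr_gt0.
  suff H n : forall x y, a <= x -> x <= y -> y <= b -> y - x <= n%:R * (d / 2) ->
      `|F y * G y - F x * G x - itg x y h| <= e * itg x y k.
    move=> x y ax xy yb.
    have [n nP] : exists n : nat, (y - x) / (d / 2) <= n%:R.
      by exists (Num.bound ((y - x) / (d / 2))); apply: ltW; apply: archi_boundP; rewrite divr_ge0 ?subr_ge0 ?(ltW d20).
    by apply: (H n) => //; rewrite -ler_pdivrMr.
  elim: n => [|n IH] x y ax xy yb.
    rewrite mul0r subr_le0 => yx; apply: dP => //.
    by rewrite (le_lt_trans _ d0)// subr_le0.
  case: (leP (y - x) (d / 2)) => yxd yxn.
    by apply: dP => //; rewrite (le_lt_trans yxd)// ltr_pdivrMr// ltr_pMr// ltr1n.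
  have yxd' : y - (x + d / 2) <= n%:R * (d / 2).
    by rewrite opprD addrA lerBlDr; move: yxn; rewrite mulrSr mulrDl mul1r.
  pose z := x + d / 2.
  have xz : x <= z by rewrite lerDl ltW.
  have zy : z <= y by rewrite /z -lerBrDl ltW.
  have A1 := dP x z ax xz (le_trans zy yb).
  have zxd : z - x < d by rewrite /z addrAC subrr add0r; lra.
  have A2 := IH z y (le_trans ax xz) zy yb yxd'.
  have S u (ui : intg a b u) : itg x y u = itg x z u + itg z y u.
    by apply: itg_cat => //; exact: intg_sub ui.
  rewrite !S// mulrDr.
  have -> : F y * G y - F x * G x - (itg x z h + itg z y h) =
    (F z * G z - F x * G x - itg x z h) + (F y * G y - F z * G z - itg z y h).
    by ring.
  by rewrite (le_trans (ler_normD _ _))// lerD// A1.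
split=> // x /andP[ax xb].
apply/eqP; rewrite addrC -subr_eq -subr_eq0 -normr_le0.
apply/ler_addgt0Pl => e e0; rewrite addr0.
have K0 : 0 <= itg a x k.
  by apply: itg_ge0 => t _; rewrite addr_ge0.
have e1 : 0 < e / (1 + itg a x k) by rewrite divr_gt0// ltr_pwDl.
rewrite (le_trans (long _ e1 a x (lexx _) ax xb))//.
rewrite mulrAC ler_pdivrMr ?ltr_pwDl// ler_wpM2l ?lerDr//; exact: ltW.
Qed.

End Primitives.

(** * Continuity at 0 of polynomial expressions *)

Section ContinuityAt0.
Variable R : realType.
Definition cont0 (f : R -> R) := {for 0, continuous f}.
Lemma cont0_cst c : cont0 (fun=> c). Proof. exact: cvg_cst. Qed.
Lemma cont0D (f g : R -> R) : cont0 f -> cont0 g -> cont0 (fun x => f x + g x).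
Proof. by move=> cf cg; apply: cvgD. Qed.
Lemma cont0N (f : R -> R) : cont0 f -> cont0 (fun x => - f x).
Proof. by move=> cf; apply: cvgN. Qed.
Lemma cont0M (f g : R -> R) : cont0 f -> cont0 g -> cont0 (fun x => f x * g x).
Proof. by move=> cf cg; apply: cvgM. Qed.
End ContinuityAt0.

Ltac solve_cont0 :=
  lazymatch goal with
  | |- cont0 (fun=> ?c) => exact: cont0_cst
  | |- cont0 (fun x => @?f x + @?g x) =>
      apply (@cont0D _ f g); cbv beta; solve_cont0
  | |- cont0 (fun x => @?f x * @?g x) =>
      apply (@cont0M _ f g); cbv beta; solve_cont0
  | |- cont0 (fun x => - @?f x) => apply (@cont0N _ f); cbv beta; solve_cont0
  | |- _ => assumption
  end.

(** * The energy of a function clamped at one end of a quarter circle *)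

Section QuarterCircle.
Variable R : realType.
Local Notation mu := (@lebesgue_measure R).
Implicit Types (a b c x y e l t : R) (f g h F G : R -> R).

Lemma derive_continuous F x d : is_derive x 1 F d -> {for x, continuous F}.
Proof. by move=> FD; apply/differentiable_continuous/derivable1_diffP. Qed.

Lemma prim_derive a b F f : (forall x, a <= x <= b -> is_derive x 1 F (f x)) ->
  {within `[a, b], continuous f} -> prim a b F f.
Proof.
move=> FD cf; split; first exact: intg_cont.
move=> x /andP[]; rewrite le_eqVlt => /predU1P[<- _|ax xb].
  by rewrite itg_xx addr0.
have cF y : a <= y <= b -> {for y, continuous F}.
  by move=> yab; apply: (derive_continuous (FD y yab)).
rewrite /itg /Rintegral (@continuous_FTC2 _ f F a x)//.
- by rewrite -EFinB /=; ring.
- by apply: continuous_subspaceW cf; apply: subset_itv; rewrite bnd_simp.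
- split.
  + move=> y; rewrite in_itv/= => /andP[ay yx].
    have := FD y; rewrite (ltW ay) (le_trans (ltW yx) xb) => /(_ isT) yD.
    exact: ex_derive.
  + apply: cvg_at_right_filter; apply: cF; rewrite lexx.
    by rewrite (le_trans (ltW ax)).
  + by apply: cvg_at_left_filter; apply: cF; rewrite (ltW ax).
- move=> y; rewrite in_itv/= => /andP[ay yx].
  have := FD y; rewrite (ltW ay) (le_trans (ltW yx) xb) => /(_ isT) yD.
  by rewrite derive1E derive_val.
Qed.

Lemma prim_derivable a b F f : (forall x, is_derive x 1 F (f x)) ->
  continuous f -> prim a b F f.
Proof.
by move=> FD cf; apply: prim_derive => //; exact: continuous_subspaceT.
Qed.

Lemma prim_sin a b : prim a b (@sin R) (@cos R).
Proof. by apply: prim_derivable; exact: continuous_cos. Qed.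

Lemma prim_cos a b : prim a b (@cos R) (fun x => - sin x).
Proof.
apply: prim_derivable => x; exact: (continuousN (@continuous_sin R x)).
Qed.

Lemma ge0_at0 (Q : R -> R) d : 0 < d -> {for 0, continuous Q} ->
  (forall e, 0 < e < d -> 0 <= Q e) -> 0 <= Q 0.
Proof.
move=> d0 cQ Q0; rewrite leNgt; apply/negP => Qlt0.
have /nbhs_ballP[r /= r0 rP] : \forall e \near 0, Q e < 0 by apply: (cvgr_lt _ cQ).
pose e := Num.min (r / 2) (d / 2).
have e0 : 0 < e by rewrite lt_min !divr_gt0.
have er : e < r.
  by rewrite (@le_lt_trans _ _ (r / 2)) ?ge_min ?lexx// ltr_pdivrMr// ltr_pMr// ltr1n.
have ed : e < d.
  by rewrite (@le_lt_trans _ _ (d / 2)) ?ge_min ?lexx ?orbT// ltr_pdivrMr// ltr_pMr// ltr1n.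
have := Q0 e; rewrite e0 ed => /(_ isT); rewrite leNgt => /negP; apply.
by apply: rP; rewrite /ball/= sub0r normrN gtr0_norm.
Qed.

Lemma sin_shift_gt0 e x : 0 < e < pi / 2 -> 0 <= x <= pi / 2 -> 0 < sin (x + e).
Proof.
move=> /andP[e0 e1] /andP[x0 x1]; apply: sin_gt0_pi.
have := splitr (pi : R); move: (pi / 2) e1 x1 => p e1 x1 ->.
by rewrite ltr_wpDl//= ler_ltD.
Qed.

Definition cotr e x := cos (x + e) / sin (x + e).
Definition cscr e x := (sin (x + e))^-1.

Lemma csc2 e x : sin (x + e) != 0 -> cscr e x ^+ 2 = 1 + cotr e x ^+ 2.
Proof.
move=> s0; rewrite /cscr /cotr exprMn cos2sin2.
by move: (sin _) s0 => s s0; field.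
Qed.

Lemma prim_csc e : 0 < e < pi / 2 ->
  prim 0 (pi / 2) (cscr e) (fun x => - (cotr e x * cscr e x)).
Proof.
move=> e_; have sP x : 0 <= x <= pi / 2 -> sin (x + e) != 0.
  by move=> xp; rewrite gt_eqF// sin_shift_gt0.
have sD x : is_derive x 1 (fun x => sin (x + e)) (cos (x + e)).
  have -> : cos (x + e) = cos (x + e) * (1 + 0) by rewrite addr0 mulr1.
  exact: (@is_derive1_comp _ sin (fun x => x + e)).
have cD x : is_derive x 1 (fun x => cos (x + e)) (- sin (x + e)).
  have -> : - sin (x + e) = - sin (x + e) * (1 + 0) by rewrite addr0 mulr1.
  exact: (@is_derive1_comp _ cos (fun x => x + e)).
apply: prim_derive => [x xp|].
  apply: (is_derive_eq (is_deriveV (sP x xp) (sD x))).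
  rewrite /cotr /cscr /GRing.scale/= mulNr mulrC.
  congr (- _); have := sP x xp; move: (sin _) (cos _) => s c s0.
  by field.
apply: continuous_in_subspaceT => x; rewrite inE/= in_itv/= => xp.
apply: cvgN; apply: cvgM; first apply: cvgM; [| |].
- exact: derive_continuous (cD x).
- by apply: cvgV; [exact: sP|exact: derive_continuous (sD x)].
- by apply: cvgV; [exact: sP|exact: derive_continuous (sD x)].
Qed.

Lemma prim_cot e : 0 < e < pi / 2 ->
  prim 0 (pi / 2) (cotr e) (fun x => - (1 + cotr e x ^+ 2)).
Proof.
move=> e_; have sP x : 0 <= x <= pi / 2 -> sin (x + e) != 0.
  by move=> xp; rewrite gt_eqF// sin_shift_gt0.
have p0 : 0 <= pi / 2 :> R by rewrite divr_ge0// pi_ge0.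
have cD x : is_derive x 1 (fun x => cos (x + e)) (- sin (x + e)).
  have -> : - sin (x + e) = - sin (x + e) * (1 + 0) by rewrite addr0 mulr1.
  exact: (@is_derive1_comp _ cos (fun x => x + e)).
have sD x : is_derive x 1 (fun x => sin (x + e)) (cos (x + e)).
  have -> : cos (x + e) = cos (x + e) * (1 + 0) by rewrite addr0 mulr1.
  exact: (@is_derive1_comp _ sin (fun x => x + e)).
have pc : prim 0 (pi / 2) (fun x => cos (x + e)) (fun x => - sin (x + e)).
  apply: prim_derivable => // x; apply: cvgN.
  exact: derive_continuous (sD x).
apply: eq_prim (primM p0 pc (prim_csc e_)) => //= x /sP s0.
rewrite /cotr /cscr; move: (sin _) (cos _) s0 => s c s0.
by field.
Qed.

Definition eform (w w1 w2 : R -> R) x := w2 x ^+ 2 - 10 * w1 x ^+ 2 + 9 * w x ^+ 2.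

Section Clamped.
Variables w w1 w2 : R -> R.
Hypothesis pw : prim 0 (pi / 2) w w1.
Hypothesis pw1 : prim 0 (pi / 2) w1 w2.
Hypothesis w2i : intg 0 (pi / 2) (fun x => w2 x ^+ 2).
Hypothesis w0 : w 0 = 0.
Hypothesis w10 : w1 0 = 0.

Let p0 : 0 <= pi / 2 :> R. Proof. by rewrite divr_ge0// pi_ge0. Qed.

Let J (x : R) : R := itg 0 x (eform w w1 w2).

Let pJ : prim 0 (pi / 2) J (eform w w1 w2).
Proof.
have i1 : intg 0 (pi / 2) (fun x => w1 x ^+ 2).
  exact: intgM (prim_cont p0 pw1) (intg_cont (prim_cont p0 pw1)).
have i0 : intg 0 (pi / 2) (fun x => w x ^+ 2).
  exact: intgM (prim_cont p0 pw) (intg_cont (prim_cont p0 pw)).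
split; last by move=> x _; rewrite /J itg_xx add0r.
apply: intgD; last exact: intgZ.
by apply: intgB => //; exact: intgZ.
Qed.

(* [lop e] annihilates [sin (x + e) ^ 3] and [sin (x + e) ^ 2 * cos (x + e)];
   its square is the energy density plus the derivative of [bdry]. The shift
   [e > 0] keeps [cot] finite at [0] and is sent to [0] at the end. *)
Let lop (e x : R) : R := w2 x - 4 * cotr e x * w1 x + 3 * (1 + 2 * cotr e x ^+ 2) * w x.

Let bdry (k v v1 : R) : R := - 4 * (k * (v1 * v1)) + 6 * (v * v1 + 2 * ((k * k) * (v * v1)))
  - 12 * (((k * k) * k) * (v * v)).

Let prim_sq e : 0 < e < pi / 2 ->
  prim 0 (pi / 2) (fun x => bdry (cotr e x) (w x) (w1 x) + J x)
    (fun x => lop e x ^+ 2).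
Proof.
move=> e_; have pK := prim_cot e_.
have pKK := primM p0 pK pK.
have pww1 := primM p0 pw pw1.
have := primD (primB (primD
  (primZ (- 4) (primM p0 pK (primM p0 pw1 pw1)))
  (primZ 6 (primD pww1 (primZ 2 (primM p0 pKK pww1)))))
  (primZ 12 (primM p0 (primM p0 pKK pK) (primM p0 pw pw)))) pJ.
by apply: eq_prim => x _; rewrite ?/bdry// /lop /eform; ring.
Qed.

(** Let [f = w / sin^3] be read as a function of [- cot], all at [x + e]. Then
    [f' = w1 / sin - 3 w cot / sin] and [f'' = sin * lop e], and the primitive is
    [(t - cot) f' - f], the one behind the integral remainder in Taylor's formula. *)
Let prim_f e : 0 < e < pi / 2 -> forall t,
  prim 0 (pi / 2) (fun x => (t - cotr e x) * (cscr e x * w1 x -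
      3 * (cotr e x * (cscr e x * w x))) - cscr e x * (cscr e x * (cscr e x * w x)))
    (fun x => (t - cotr e x) * cscr e x * lop e x).
Proof.
move=> e_ t; have pK := prim_cot e_; have pr := prim_csc e_.
have prw := primM p0 pr pw.
have := primB (primM p0 (primB (prim_cst _ _ t) pK)
   (primB (primM p0 pr pw1) (primZ 3 (primM p0 pK prw))))
   (primM p0 pr (primM p0 pr prw)).
apply: eq_prim => // x xp; rewrite /lop.
have /csc2 : sin (x + e) != 0 by rewrite gt_eqF// sin_shift_gt0.
move: (cscr _ _) (cotr _ _) => r k r2.
have k2 : k ^+ 2 = r ^+ 2 - 1 by rewrite r2; ring.
have k3 : k ^+ 3 = k * (r ^+ 2 - 1) by rewrite -k2; ring.
ring: k2 k3.
Qed.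

(* The right-hand side minus the left-hand side is the integral over [t, pi / 2] of
   [(l X - lop e) ^ 2 / (2 l)], where [X x = (cot (t + e) - cot (x + e)) / sin (x + e)],
   plus the integral over [0, t] of [lop e ^ 2 / (2 l)]. *)
Let clamped_eps e l t : 0 < e < pi / 2 -> 0 < l -> 0 <= t <= pi / 2 ->
  cscr e t * (cscr e t * (cscr e t * w t)) <=
  l / 6 * (cotr e t - cotr e (pi / 2)) ^+ 3
  + (2 * l)^-1 * (bdry (cotr e (pi / 2)) (w (pi / 2)) (w1 (pi / 2)) + J (pi / 2))
  - ((cotr e t - cotr e (pi / 2)) * (cscr e (pi / 2) * w1 (pi / 2) -
      3 * (cotr e (pi / 2) * (cscr e (pi / 2) * w (pi / 2))))
     - cscr e (pi / 2) * (cscr e (pi / 2) * (cscr e (pi / 2) * w (pi / 2)))).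
Proof.
move=> e_ l0 /andP[t0 tp]; set T := cotr e t.
have ps := prim_sq e_; have pf := prim_f e_ T.
have pTK := primB (prim_cst 0 (pi / 2) T) (prim_cot e_).
have pT3 := primM p0 pTK (primM p0 pTK pTK).
have pPsi := primB (primD (primZ (l / 6) pT3) (primZ (2 * l)^-1 ps)) pf.
have := prim_diff pPsi t0 tp (lexx _).
rewrite -/T subrr !mul0r mulr0 add0r sub0r opprK => E.
have ge0 : 0 <= itg t (pi / 2) (fun x => l / 6 *
    ((0 - - (1 + cotr e x ^+ 2)) * ((T - cotr e x) * (T - cotr e x)) +
     (T - cotr e x) * ((0 - - (1 + cotr e x ^+ 2)) * (T - cotr e x) +
     (T - cotr e x) * (0 - - (1 + cotr e x ^+ 2)))) +
   (2 * l)^-1 * lop e x ^+ 2 - (T - cotr e x) * cscr e x * lop e x).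
  apply: itg_ge0 => x /andP[tx xp].
  have /csc2 r2 : sin (x + e) != 0.
    by rewrite gt_eqF// sin_shift_gt0// (le_trans t0 tx).
  have -> : l / 6 *
    ((0 - - (1 + cotr e x ^+ 2)) * ((T - cotr e x) * (T - cotr e x)) +
     (T - cotr e x) * ((0 - - (1 + cotr e x ^+ 2)) * (T - cotr e x) +
     (T - cotr e x) * (0 - - (1 + cotr e x ^+ 2)))) +
     (2 * l)^-1 * lop e x ^+ 2 - (T - cotr e x) * cscr e x * lop e x =
     (2 * l)^-1 * (l * ((T - cotr e x) * cscr e x) - lop e x) ^+ 2.
    rewrite -r2 sub0r opprK.
    move: (cscr _ _) (cotr _ _) (lop _ _) => r k L.
    by field; rewrite gt_eqF.
  by rewrite mulr_ge0 ?sqr_ge0// invr_ge0 mulr_ge0// ltW.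
(* [w] and [w1] vanish at 0, so [bdry] vanishes there however large [cot e] is, and the left-over
   quantity is the integral of [lop e ^ 2] over [[0, t]]. *)
have sq0 : 0 <= bdry (cotr e t) (w t) (w1 t) + J t.
  have := prim_diff ps (lexx 0) t0 tp.
  rewrite {2}/bdry w0 w10 {2}/J itg_xx.
  rewrite !(mulr0, mul0r, add0r, addr0, subr0) => ->.
  by apply: itg_ge0 => x _; exact: sqr_ge0.
have sq1 : 0 <= (2 * l)^-1 * (bdry (cotr e t) (w t) (w1 t) + J t).
  by rewrite mulr_ge0// invr_ge0 mulr_ge0// ltW.
rewrite -subr_ge0; move: ge0 sq1; rewrite -E -/T => ge0 sq1.
apply: le_trans (addr_ge0 ge0 sq1) _.
by rewrite le_eqVlt; apply/orP; left; apply/eqP; ring.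
Qed.

(** Formally the integral of [f''^2] over the half line that corresponds to the quarter: at [pi / 2]
    the cotangent vanishes and [bdry] keeps only the term [6 w w1]. *)
Definition quarter_energy : R := itg 0 (pi / 2) (eform w w1 w2) + 6 * (w (pi / 2) * w1 (pi / 2)).

(** Taylor's formula for [w / sin^3] in the variable [- cot], centred at [pi / 2]. Young's
    inequality with weight [l] splits the remainder into a square, which integrates to
    [l / 6 * cot^3], and [quarter_energy / (2 l)]; the result is multiplied by [sin t ^ 3]. *)
Lemma clamped_bound l t : 0 < l -> 0 < t <= pi / 2 ->
  w t <= sin t ^+ 3 * w (pi / 2) - sin t ^+ 2 * cos t * w1 (pi / 2)
    + l / 6 * cos t ^+ 3 + sin t ^+ 3 / (2 * l) * quarter_energy.
Proof.
move=> l0 /andP[t0 tp].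
pose Q e := l / 6 * (cotr e t - cotr e (pi / 2)) ^+ 3
  + (2 * l)^-1 * (bdry (cotr e (pi / 2)) (w (pi / 2)) (w1 (pi / 2)) + J (pi / 2))
  - ((cotr e t - cotr e (pi / 2)) * (cscr e (pi / 2) * w1 (pi / 2) -
      3 * (cotr e (pi / 2) * (cscr e (pi / 2) * w (pi / 2))))
     - cscr e (pi / 2) * (cscr e (pi / 2) * (cscr e (pi / 2) * w (pi / 2)))) -
  cscr e t * (cscr e t * (cscr e t * w t)).
have s0 : sin t != 0.
  rewrite gt_eqF// sin_gt0_pi// t0 (le_lt_trans tp)//.
  by rewrite ltr_pdivrMr// ltr_pMr ?pi_gt0// ltr1n.
have p20 : 0 < pi / 2 :> R by rewrite divr_gt0// pi_gt0.
have Q0 : 0 <= Q 0.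
  apply: (ge0_at0 p20); last first.
    move=> e e_; rewrite subr_ge0; apply: clamped_eps => //.
    by rewrite (ltW t0).
  rewrite -/(cont0 Q).
  have shift_cont x : {for 0, continuous (fun e : R => x + e)}.
    by apply: cvgD; [exact: cvg_cst|exact: cvg_id].
  have cs x : cont0 (fun e : R => sin (x + e)).
    by apply: continuous_comp; [exact: shift_cont|exact: continuous_sin].
  have cc x : cont0 (fun e : R => cos (x + e)).
    by apply: continuous_comp; [exact: shift_cont|exact: continuous_cos].
  have cr x : sin x != 0 -> cont0 (fun e : R => cscr e x).
    by move=> sx; apply: cvgV; [rewrite addr0|exact: cs].
  have ck x : sin x != 0 -> cont0 (fun e : R => cotr e x).
    by move=> sx; apply: cvgM; [exact: cc|exact: cr].
  have s1 : sin (pi / 2) != 0 :> R by rewrite sin_pihalf oner_neq0.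
  have := (ck _ s1, cr _ s1, ck _ s0, cr _ s0).
  rewrite /Q /bdry => -[[[c1 c2] c3] c4].
  have e3 (u : R) : u ^+ 3 = u * (u * u) by rewrite !exprS expr0 mulr1.
  rewrite (_ : (fun e => _) = (fun e => l / 6 * ((cotr e t - cotr e (pi / 2)) *
     ((cotr e t - cotr e (pi / 2)) * (cotr e t - cotr e (pi / 2))))
  + (2 * l)^-1 * (bdry (cotr e (pi / 2)) (w (pi / 2)) (w1 (pi / 2)) + J (pi / 2))
  - ((cotr e t - cotr e (pi / 2)) * (cscr e (pi / 2) * w1 (pi / 2) -
      3 * (cotr e (pi / 2) * (cscr e (pi / 2) * w (pi / 2))))
     - cscr e (pi / 2) * (cscr e (pi / 2) * (cscr e (pi / 2) * w (pi / 2)))) -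
  cscr e t * (cscr e t * (cscr e t * w t)))); last by apply/funext => e; rewrite e3.
  by rewrite /bdry; solve_cont0.
have p3 : 0 <= sin t ^+ 3.
  by rewrite exprn_ge0// sin_ge0_pi// (ltW t0)/= (le_trans tp)// ler_pdivrMr// ler_pMr ?pi_gt0// ler1n.
have := mulr_ge0 p3 Q0; rewrite -[in X in _ -> X]subr_ge0.
rewrite /Q /bdry /cotr /cscr !addr0 sin_pihalf cos_pihalf /quarter_energy -/(J _).
congr (0 <= _); move: (sin t) (cos t) s0 => s c s0'.
by field; rewrite s0'/= gt_eqF.
Qed.

(** At [t = pi / 2] and [l = 1] the bound compares [w (pi / 2)] with itself plus half the energy. *)
Lemma clamped_energy_ge0 : 0 <= quarter_energy.
Proof.
have t1 : 0 < (pi / 2 : R) <= pi / 2 by rewrite lexx divr_gt0// pi_gt0.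
rewrite leNgt; apply/negP => e0.
have := @clamped_bound 1 (pi / 2) ltr01 t1.
rewrite sin_pihalf cos_pihalf => H.
have : 0 <= 1 / (2 * 1) * quarter_energy by move: H; rewrite !expr1n; lra.
by rewrite leNgt => /negP; apply; rewrite pmulr_rlt0// divr_gt0// mulr_gt0.
Qed.

End Clamped.
End QuarterCircle.

(** * Translations and reflections of integrals and primitives *)

Section AffineChange.
Variable R : realType.
Local Notation mu := (@lebesgue_measure R).
Implicit Types (a b c d x y : R) (f g F : R -> R).

Section MeasurePreserving.
Variable phi : measurableTypeR R -> measurableTypeR R.
Hypothesis mphi : measurable_fun setT phi.
Hypothesis phi_mu : forall A, measurable A -> pushforward mu phi A = mu A.
Variables a b c d : R.
Hypothesis phi_itv : phi @^-1` [set` `[c, d]] = [set` `[a, b]].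

Let ge0_comp (h : R -> \bar R) : measurable_fun [set` `[c, d]] h ->
  (forall x, 0 <= h x)%E ->
  (\int[mu]_(x in [set` `[a, b]]) h (phi x) = \int[mu]_(x in [set` `[c, d]]) h x)%E.
Proof.
move=> mh h0; rewrite -phi_itv.
have -> : (\int[mu]_(x in [set` `[c, d]]) h x =
           \int[pushforward mu phi]_(x in [set` `[c, d]]) h x)%E.
  by apply: eq_measure_integral => //= A mA _; exact/esym/phi_mu.
by rewrite ge0_integral_pushforward.
Qed.

Lemma intg_comp f : intg c d f -> intg a b (fun x => f (phi x)).
Proof.
move=> fi; have mf := intg_measurable fi.
have mfp : measurable_fun [set` `[a, b]] (fun x => f (phi x)).
  apply: (@measurable_comp _ _ _ _ _ _ [set` `[c, d]]) => //.
    by rewrite -phi_itv => _ [x /= xcd <-].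
  exact: measurable_funTS.
apply/integrableP; split; first exact/measurable_EFinP.
rewrite (ge0_comp (h := fun x => `|(f x)%:E|%E))//.
  by case/integrableP: fi.
by apply: measurableT_comp => //; exact/measurable_EFinP.
Qed.

Lemma itg_comp f : intg c d f -> itg a b (fun x => f (phi x)) = itg c d f.
Proof.
move=> fi; have mf : measurable_fun [set` `[c, d]] (EFin \o f).
  by apply/measurable_EFinP; exact: intg_measurable.
rewrite /itg /Rintegral integralE [in RHS]integralE; congr (fine (_ - _))%E.
  have <- := ge0_comp (measurable_funepos mf) (@funepos_ge0 _ _ _).
  by apply: eq_integral => x _; rewrite !funepos.unlock.
have <- := ge0_comp (measurable_funeneg mf) (@funeneg_ge0 _ _ _).
by apply: eq_integral => x _; rewrite !funeneg.unlock.
Qed.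

End MeasurePreserving.

Let mshift c : measurable_fun setT (fun x : measurableTypeR R => c + x : measurableTypeR R).
Proof. exact: measurable_funD. Qed.

Let mu_shift c A : measurable A ->
  pushforward mu (fun x : measurableTypeR R => c + x : measurableTypeR R) A = mu A.
Proof.
move=> mA; apply/esym/lebesgue_measure_unique => //= _ [[a b]] _ <-.
rewrite /pushforward.
have -> : (fun x => c + x) @^-1` [set` `]a, b]] = [set` `]a - c, b - c]].
  by apply/seteqP; split=> x /=; rewrite !in_itv/= ltrBlDl lerBrDl.
rewrite !lebesgue_measure_itv/= !lte_fin ltrD2r.
case: ifP => // _; rewrite -!EFinB; congr (_%:E); ring.
Qed.

Let mreflect c : measurable_fun setT (fun x : measurableTypeR R => c - x : measurableTypeR R).
Proof. exact: measurable_funB. Qed.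

(** The reflection is negation followed by a translation, so the claim reduces to invariance of the
    measure under each. *)
Let mu_reflect c A : measurable A ->
  pushforward mu (fun x : measurableTypeR R => c - x : measurableTypeR R) A = mu A.
Proof.
move=> mA.
have mB := mshift c measurableT mA; rewrite setTI in mB.
by rewrite -[RHS](mu_shift c mA) -[RHS](lebesgue_measureN mB).
Qed.

Let shift_itv a b c : (fun x => c + x) @^-1` [set` `[c + a, c + b]] = [set` `[a, b]].
Proof. by apply/seteqP; split=> x /=; rewrite !in_itv/= !lerD2l. Qed.

Let reflect_itv a b c : (fun x => c - x) @^-1` [set` `[c - b, c - a]] = [set` `[a, b]].
Proof. by apply/seteqP; split=> x /=; rewrite !in_itv/= !lerD2l !lerN2 andbC. Qed.

Lemma intg_shift a b c f : intg (c + a) (c + b) f -> intg a b (fun x => f (c + x)).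
Proof. exact: (intg_comp (mshift c) (@mu_shift c) (shift_itv a b c)). Qed.

Lemma itg_shift a b c f : intg (c + a) (c + b) f ->
  itg a b (fun x => f (c + x)) = itg (c + a) (c + b) f.
Proof. exact: (itg_comp (mshift c) (@mu_shift c) (shift_itv a b c)). Qed.

Lemma intg_reflect a b c f : intg (c - b) (c - a) f -> intg a b (fun x => f (c - x)).
Proof. exact: (intg_comp (mreflect c) (@mu_reflect c) (reflect_itv a b c)). Qed.

Lemma itg_reflect a b c f : intg (c - b) (c - a) f ->
  itg a b (fun x => f (c - x)) = itg (c - b) (c - a) f.
Proof. exact: (itg_comp (mreflect c) (@mu_reflect c) (reflect_itv a b c)). Qed.

Lemma prim_shift a b c F f : prim (c + a) (c + b) F f ->
  prim a b (fun x => F (c + x)) (fun x => f (c + x)).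
Proof.
move=> [fi PF]; split; first exact: intg_shift.
move=> x /andP[ax xb]; rewrite PF ?lerD2l ?ax// itg_shift//.
by apply: intg_sub fi; rewrite // lerD2l.
Qed.

Lemma prim_reflect a b c F f : prim (c - b) (c - a) F f ->
  prim a b (fun x => F (c - x)) (fun x => - f (c - x)).
Proof.
move=> PF; have fi := intg_reflect PF.1.
split; first exact: intgN.
move=> x /andP[ax xb].
have fi' : intg (c - x) (c - a) f by apply: intg_sub PF.1; rewrite // lerD2l lerN2.
rewrite itgN; last exact: intg_sub fi.
rewrite itg_reflect// -(prim_diff PF) ?lerD2l ?lerN2//; first by ring.
Qed.

End AffineChange.

(** * From the clamped quarter circle to the whole circle *)

Section FourQuarters.
Variable R : realType.
Implicit Types (a b c x y l t : R).

Section OneQuarter.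
Variables (v v1 v2 : R -> R) (m : R).
Hypothesis pv : prim 0 (pi / 2) v v1.
Hypothesis pv1 : prim 0 (pi / 2) v1 v2.
Hypothesis v2i : intg 0 (pi / 2) (fun x => v2 x ^+ 2).

Let A := v 0 - m.
Let B := v1 0.
Let V := v (pi / 2).
Let V1 := v1 (pi / 2).
Let p0 : 0 <= pi / 2 :> R. Proof. by rewrite divr_ge0// pi_ge0. Qed.

Let s := @sin R.
Let c := @cos R.
(* [z] lies in the kernel of [D^4 + 10 D^2 + 9], and [z] agrees with [v] to first order at [0]. *)
Let z x := A * c x + B * s x + m * (c x * (c x * c x)).
Let z1 x := - A * s x + B * c x - 3 * m * (c x * (c x * s x)).
Let z2 x := - A * c x - B * s x + m * (6 * (c x * (s x * s x)) - 3 * (c x * (c x * c x))).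
Let z3 x := A * s x - B * c x + m * (21 * (c x * (c x * s x)) - 6 * (s x * (s x * s x))).

Let ps := prim_sin 0 (pi / 2 : R).
Let pc := prim_cos 0 (pi / 2 : R).
Let pcc := primM p0 pc pc.

Let pz : prim 0 (pi / 2) z z1.
Proof.
have := primD (primD (primZ A pc) (primZ B ps)) (primZ m (primM p0 pc pcc)).
by apply: eq_prim => x _ //; rewrite /z1 /c /s; ring.
Qed.

Let pz1 : prim 0 (pi / 2) z1 z2.
Proof.
have := primB (primD (primZ (- A) ps) (primZ B pc))
  (primZ (3 * m) (primM p0 pc (primM p0 pc ps))).
by apply: eq_prim => x _ //; rewrite /z2 /c /s; ring.
Qed.

Let pz2 : prim 0 (pi / 2) z2 z3.
Proof.
have := primD (primB (primZ (- A) pc) (primZ B ps))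
  (primZ m (primB (primZ 6 (primM p0 pc (primM p0 ps ps))) (primZ 3 (primM p0 pc pcc)))).
by apply: eq_prim => x _ //; rewrite /z3 /c /s; ring.
Qed.

Let pz3 : prim 0 (pi / 2) z3 (fun x => - 10 * z2 x - 9 * z x).
Proof.
have := primD (primB (primZ A ps) (primZ B pc))
  (primZ m (primB (primZ 21 (primM p0 pc (primM p0 pc ps)))
    (primZ 6 (primM p0 ps (primM p0 ps ps))))).
by apply: eq_prim => x _ //; rewrite /z2 /z /c /s; ring.
Qed.

Let w x := v x - z x.
Let w1 x := v1 x - z1 x.
Let w2 x := v2 x - z2 x.

Let pw : prim 0 (pi / 2) w w1. Proof. exact: primB pv pz. Qed.
Let pw1 : prim 0 (pi / 2) w1 w2. Proof. exact: primB pv1 pz1. Qed.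

Let w2i : intg 0 (pi / 2) (fun x => w2 x ^+ 2).
Proof.
have cz2 := prim_cont p0 pz2.
have i1 := intgM cz2 pv1.1.
have i2 := intgM cz2 (intg_cont cz2).
apply: eq_intg (intgD (intgB v2i (intgZ 2 i1)) i2) => x _.
by rewrite /w2; ring.
Qed.

Let w0 : w 0 = 0.
Proof. by rewrite /w /z /c /s sin0 cos0 /A; ring. Qed.

Let w10 : w1 0 = 0.
Proof. by rewrite /w1 /z1 /c /s sin0 cos0 /B; ring. Qed.

(** The boundary terms that appear when the energy of [v] is replaced by that of the clamped
    [v - z]: the product [6 w w1] at [pi / 2], then the Green terms at both ends of the pairing of
    [z] with [2 w + z]. *)
Definition quarter_corr : R :=
  6 * (V - B) * (V1 + A) - 2 * (- B * (V1 + A) - (A - 6 * m) * (V - B) + 10 * A * (V - B))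
  - (18 * m * B + 20 * A * B).

Let quarter_energyE :
  quarter_energy w w1 w2 = itg 0 (pi / 2) (eform v v1 v2) + quarter_corr.
Proof.
have ie (f f1 f2 : R -> R) : prim 0 (pi / 2) f f1 -> prim 0 (pi / 2) f1 f2 ->
    intg 0 (pi / 2) (fun x => f2 x ^+ 2) -> intg 0 (pi / 2) (eform f f1 f2).
  move=> pf pf1 f2i.
  have i1 := intgM (prim_cont p0 pf1) (intg_cont (prim_cont p0 pf1)).
  have i0 := intgM (prim_cont p0 pf) (intg_cont (prim_cont p0 pf)).
  by apply: eq_intg (intgD (intgB f2i (intgZ 10 i1)) (intgZ 9 i0)).
(* The difference of the two energies is the pairing of [z] with [2 w + z]. As
   [z'''' + 10 z'' + 9 z = 0], it is exact, with the Green bracket as primitive. *)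
have pT : prim 0 (pi / 2)
    (fun x => z2 x * (2 * w1 x + z1 x) - z3 x * (2 * w x + z x)
              - 10 * (z1 x * (2 * w x + z x)))
    (fun x => eform v v1 v2 x - eform w w1 w2 x).
  have p2wz := primD (primZ 2 pw) pz.
  have p2wz1 := primD (primZ 2 pw1) pz1.
  have := primB (primB (primM p0 pz2 p2wz1) (primM p0 pz3 p2wz))
    (primZ 10 (primM p0 pz1 p2wz)).
  apply: eq_prim => x _ //; rewrite /eform.
  have -> : v x = w x + z x by rewrite /w; ring.
  have -> : v1 x = w1 x + z1 x by rewrite /w1; ring.
  have -> : v2 x = w2 x + z2 x by rewrite /w2; ring.
  by ring.
have := prim_itg p0 pT.
rewrite itgB; [|exact: ie|exact: ie].
rewrite /quarter_energy w0 w10 => /eqP; rewrite subr_eq addrC -subr_eq => /eqP <-.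
rewrite /w /w1 /z /z1 /z2 /z3 /c /s sin0 cos0 sin_pihalf cos_pihalf -/V -/V1.
by rewrite /quarter_corr; ring.
Qed.

Lemma quarter_energy_ge0 : 0 <= itg 0 (pi / 2) (eform v v1 v2) + quarter_corr.
Proof. by rewrite -quarter_energyE; exact: clamped_energy_ge0. Qed.

Lemma quarter_bound l t : 0 < l -> 0 < t <= pi / 2 ->
  v t <= A * cos t + B * sin t + m * cos t ^+ 3
    + sin t ^+ 3 * (V - B) - sin t ^+ 2 * cos t * (V1 + A)
    + l / 6 * cos t ^+ 3
    + sin t ^+ 3 / (2 * l) * (itg 0 (pi / 2) (eform v v1 v2) + quarter_corr).
Proof.
move=> l0 t0; have := clamped_bound pw pw1 w2i w0 w10 l0 t0.
rewrite -quarter_energyE.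
have -> : w (pi / 2) = V - B.
  by rewrite /w /z /c /s sin_pihalf cos_pihalf /V; ring.
have -> : w1 (pi / 2) = V1 + A.
  by rewrite /w1 /z1 /c /s sin_pihalf cos_pihalf /V1; ring.
rewrite {1}/w lerBlDr; congr (_ <= _); rewrite /z /c /s.
by ring.
Qed.

End OneQuarter.

Section Circle.
Variables (u p g : R -> R) (m : R).
Hypothesis pu : prim 0 (2 * pi) u p.
Hypothesis pp : prim 0 (2 * pi) p g.
Hypothesis gi : intg 0 (2 * pi) (fun x => g x ^+ 2).
Hypothesis u2pi : u (2 * pi) = u 0.
Hypothesis p2pi : p (2 * pi) = p 0.
Hypothesis um : u 0 + u pi = 2 * m.
Hypothesis pm : p 0 + p pi = 0.

Let E := itg 0 (2 * pi) (eform u p g).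
Let U := u (pi / 2) + u (pi + pi / 2).

Let q := pi / 2 : R.
Let q0 : 0 <= q. Proof. by rewrite divr_ge0// pi_ge0. Qed.
Let piE : pi = q + q :> R. Proof. exact: splitr. Qed.

(** Each quarter is run through starting from 0 or [pi], the points of clamping, and ending at a
    zero of cos, where the third derivative of [|cos|^3] jumps. *)
Let v1 x := u x.
Let v2 x := u (pi - x).
Let v3 x := u (pi + x).
Let v4 x := u (2 * pi - x).
Let dv2 x := - p (pi - x).
Let dv3 x := p (pi + x).
Let dv4 x := - p (2 * pi - x).
Let dd2 x := - - g (pi - x).
Let dd3 x := g (pi + x).
Let dd4 x := - - g (2 * pi - x).

Let Ei : intg 0 (2 * pi) (eform u p g).
Proof.
have h : 0 <= 2 * pi :> R by rewrite mulr_ge0// pi_ge0.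
have i1 := intgM (prim_cont h pp) (intg_cont (prim_cont h pp)).
have i0 := intgM (prim_cont h pu) (intg_cont (prim_cont h pu)).
by apply: eq_intg (intgD (intgB gi (intgZ 10 i1)) (intgZ 9 i0)).
Qed.

Let P2 F f : prim 0 (2 * pi) F f -> prim 0 q (fun x => F (pi - x)) (fun x => - f (pi - x)).
Proof.
move=> PF; apply: prim_reflect; apply: prim_sub PF; rewrite ?subr0; move: q0 piE; lra.
Qed.
Let P3 F f : prim 0 (2 * pi) F f -> prim 0 q (fun x => F (pi + x)) (fun x => f (pi + x)).
Proof.
move=> PF; apply: prim_shift; apply: prim_sub PF; rewrite ?addr0; move: q0 piE; lra.
Qed.
Let P4 F f : prim 0 (2 * pi) F f ->
  prim 0 q (fun x => F (2 * pi - x)) (fun x => - f (2 * pi - x)).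
Proof.
move=> PF; apply: prim_reflect; apply: prim_sub PF; rewrite ?subr0; move: q0 piE; lra.
Qed.

Let I2 f : intg 0 (2 * pi) f -> intg 0 q (fun x => f (pi - x)) /\
  itg 0 q (fun x => f (pi - x)) = itg q pi f.
Proof.
move=> fi; have e1 : q = pi - q by rewrite piE; ring.
have fi' : intg (pi - q) (pi - 0) f.
  by apply: intg_sub fi; rewrite ?subr0; move: q0 piE; lra.
split; first exact: intg_reflect.
by rewrite itg_reflect// subr0 -e1.
Qed.

Let I3 f : intg 0 (2 * pi) f -> intg 0 q (fun x => f (pi + x)) /\
  itg 0 q (fun x => f (pi + x)) = itg pi (pi + q) f.
Proof.
move=> fi.
have fi' : intg (pi + 0) (pi + q) f.
  by apply: intg_sub fi; rewrite ?addr0; move: q0 piE; lra.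
split; first exact: intg_shift.
by rewrite itg_shift// addr0.
Qed.

Let I4 f : intg 0 (2 * pi) f -> intg 0 q (fun x => f (2 * pi - x)) /\
  itg 0 q (fun x => f (2 * pi - x)) = itg (pi + q) (2 * pi) f.
Proof.
move=> fi; have e1 : pi + q = 2 * pi - q by rewrite piE; ring.
have fi' : intg (2 * pi - q) (2 * pi - 0) f.
  by apply: intg_sub fi; rewrite ?subr0; move: q0 piE; lra.
split; first exact: intg_reflect.
by rewrite itg_reflect// subr0 -e1.
Qed.

Let EE : E = itg 0 q (eform v1 p g) + itg 0 q (eform v2 dv2 dd2)
  + itg 0 q (eform v3 dv3 dd3) + itg 0 q (eform v4 dv4 dd4).
Proof.
have pi0 := pi_ge0 R.
have -> : itg 0 q (eform v2 dv2 dd2) = itg q pi (eform u p g).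
  rewrite -(I2 Ei).2; apply: eq_itg => x _.
  by rewrite /eform /v2 /dv2 /dd2; ring.
have -> : itg 0 q (eform v3 dv3 dd3) = itg pi (pi + q) (eform u p g).
  by rewrite -(I3 Ei).2.
have -> : itg 0 q (eform v4 dv4 dd4) = itg (pi + q) (2 * pi) (eform u p g).
  rewrite -(I4 Ei).2; apply: eq_itg => x _.
  by rewrite /eform /v4 /dv4 /dd4; ring.
have [h1 h2 h3 h4] : [/\ q <= pi, pi <= pi + q, pi + q <= 2 * pi & 0 <= pi + q].
  by split; move: q0 piE; lra.
have i1 : intg 0 (pi + q) (eform u p g) by apply: intg_sub Ei.
have i2 : intg 0 pi (eform u p g) by apply: intg_sub i1.
by rewrite /E (@itg_cat _ 0 (pi + q))// (@itg_cat _ 0 pi (pi + q))// (@itg_cat _ 0 q pi).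
Qed.

Let q1 : prim 0 q v1 p. Proof. by apply: prim_sub pu => //; move: q0 piE; lra. Qed.
Let q1' : prim 0 q p g. Proof. by apply: prim_sub pp => //; move: q0 piE; lra. Qed.
Let q2 : prim 0 q v2 dv2. Proof. exact: P2 pu. Qed.
Let q2' : prim 0 q dv2 dd2. Proof. exact: primN (P2 pp). Qed.
Let q3 : prim 0 q v3 dv3. Proof. exact: P3 pu. Qed.
Let q3' : prim 0 q dv3 dd3. Proof. exact: P3 pp. Qed.
Let q4 : prim 0 q v4 dv4. Proof. exact: P4 pu. Qed.
Let q4' : prim 0 q dv4 dd4. Proof. exact: primN (P4 pp). Qed.
Let g1 : intg 0 q (fun x => g x ^+ 2).
Proof. by apply: intg_sub gi => //; move: q0 piE; lra. Qed.
Let g2 : intg 0 q (fun x => dd2 x ^+ 2).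
Proof. by apply: eq_intg (I2 gi).1 => x _; rewrite /dd2 opprK. Qed.
Let g3 : intg 0 q (fun x => dd3 x ^+ 2). Proof. exact: (I3 gi).1. Qed.
Let g4 : intg 0 q (fun x => dd4 x ^+ 2).
Proof. by apply: eq_intg (I4 gi).1 => x _; rewrite /dd4 opprK. Qed.

Let e2 : pi - q = q. Proof. by rewrite piE; ring. Qed.
Let e4 : 2 * pi - q = pi + q. Proof. by rewrite piE; ring. Qed.
Let upi : u pi = 2 * m - u 0. Proof. by rewrite -um; ring. Qed.
Let ppi : p pi = - p 0. Proof. by apply/eqP; rewrite -addr_eq0 addrC pm. Qed.
Let v20 : v2 0 = 2 * m - u 0. Proof. by rewrite /v2 subr0 upi. Qed.
Let v30 : v3 0 = 2 * m - u 0. Proof. by rewrite /v3 addr0 upi. Qed.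
Let v40 : v4 0 = u 0. Proof. by rewrite /v4 subr0 u2pi. Qed.
Let dv20 : dv2 0 = p 0. Proof. by rewrite /dv2 subr0 ppi opprK. Qed.
Let dv30 : dv3 0 = - p 0. Proof. by rewrite /dv3 addr0 ppi. Qed.
Let dv40 : dv4 0 = - p 0. Proof. by rewrite /dv4 subr0 p2pi. Qed.
Let v2q : v2 q = u q. Proof. by rewrite /v2 e2. Qed.
Let dv2q : dv2 q = - p q. Proof. by rewrite /dv2 e2. Qed.
Let v4q : v4 q = u (pi + q). Proof. by rewrite /v4 e4. Qed.
Let dv4q : dv4 q = - p (pi + q). Proof. by rewrite /dv4 e4. Qed.

(** Over the four quarters [A] has signs + - - + and [B] has signs + + - -, while the end slope
    changes sign under reflection and the end value [V] does not. All products free of [m] cancel,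
    as do the terms in [m * B]; each quarter leaves [- 12 * m * V], and each of the two end values
    occurs twice. *)
Let sum_corr : quarter_corr v1 p m + quarter_corr v2 dv2 m
  + quarter_corr v3 dv3 m + quarter_corr v4 dv4 m = - (24 * m * U).
Proof.
rewrite /quarter_corr -/q v20 v30 v40 dv20 dv30 dv40 v2q dv2q v4q dv4q.
by rewrite /v1 /v3 /dv3 /U -/q; ring.
Qed.

Lemma circle_energy_ge : 24 * m * U <= E.
Proof.
have := addr_ge0 (addr_ge0 (quarter_energy_ge0 m q1 q1' g1) (quarter_energy_ge0 m q2 q2' g2))
  (addr_ge0 (quarter_energy_ge0 m q3 q3' g3) (quarter_energy_ge0 m q4 q4' g4)).
rewrite -/q; move: EE sum_corr; lra.
Qed.

(** Adding the four quarter bounds cancels [A], [B] and the slopes at the far ends, about which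
    nothing is known; [m], [U] and the energy remain. *)
Lemma circle_bound l t : 0 < l -> 0 < t <= pi / 2 ->
  u t + u (pi - t) + u (pi + t) + u (2 * pi - t) <=
  4 * m * cos t ^+ 3 + 2 * sin t ^+ 3 * U + 2 / 3 * l * cos t ^+ 3
  + sin t ^+ 3 / (2 * l) * (E - 24 * m * U).
Proof.
move=> l0 t0.
have b1 := quarter_bound m q1 q1' g1 l0 t0.
have b2 := quarter_bound m q2 q2' g2 l0 t0.
have b3 := quarter_bound m q3 q3' g3 l0 t0.
have b4 := quarter_bound m q4 q4' g4 l0 t0.
have := lerD (lerD (lerD b1 b2) b3) b4.
move=> /le_trans; apply.
rewrite -/q EE -sum_corr.
rewrite v20 v30 v40 dv20 dv30 dv40 v2q dv2q v4q dv4q.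
move: (quarter_corr v1 _ _) (quarter_corr v2 _ _) (quarter_corr v3 _ _)
  (quarter_corr v4 _ _) => c1 c2 c3 c4.
rewrite le_eqVlt; apply/orP; left; apply/eqP.
by rewrite /v1 /v3 /dv3 /U -/q; field; rewrite gt_eqF.
Qed.

End Circle.
End FourQuarters.

Ltac pi_lra R := have := pi_gt0 R; lra.

(** * The lower bound for positive functions on the circle *)

Section LowerBound.
Variable R : realType.
Implicit Types (a b c x y t : R) (f h F u p g : R -> R).

Lemma sin_le t : 0 <= t -> sin t <= t.
Proof.
move=> t0; have pid : prim 0 t (fun x : R => x) (fun=> 1).
  by apply: prim_derivable => // x; exact: cvg_cst.
have := prim_itg t0 (primB pid (prim_sin 0 t)).
rewrite sin0 !subr0 => H; rewrite -subr_ge0 -H.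
by apply: itg_ge0 => x _; rewrite subr_ge0 cos_le1.
Qed.

(** Fermat's rule in integral form. As [f] is itself a primitive, it stays within [|f c| / 2] of
    [f c] on a short interval at [c]; were [f c] nonzero, integrating over that interval on the
    proper side would push [F] below [F c]. *)
Lemma prim_crit a b c F f h : prim a b F f -> prim a b f h -> a < c < b ->
  (forall x, a <= x <= b -> F c <= F x) -> f c = 0.
Proof.
move=> PF Pf /andP[ac cb] Fmin; apply/eqP; apply/negPn/negP => fc0.
have e0 : 0 < `|f c| / 2 by rewrite divr_gt0// normr_gt0.
have [d d0 dP] := prim_small e0 Pf.
pose e := Num.min (d / 2) (Num.min (c - a) (b - c)).
have e_gt0 : 0 < e by rewrite !lt_min !subr_gt0 ac cb divr_gt0.
have ed : e < d.
  by rewrite (@le_lt_trans _ _ (d / 2)) ?ge_min ?lexx// ltr_pdivrMr// ltr_pMr// ltr1n.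
have eca : e <= c - a by rewrite !ge_min lexx orbT.
have ebc : e <= b - c by rewrite !ge_min lexx !orbT.
have acl : a <= c - e by lra.
have cbr : c + e <= b by lra.
case: (ltgtP 0 (f c)) => fc.
- have FF := prim_diff PF acl (_ : c - e <= c) (ltW cb).
  have ce : c - e <= c by lra.
  have := Fmin (c - e); rewrite acl (le_trans ce (ltW cb)) -subr_le0 FF// => /(_ isT).
  rewrite leNgt => /negP; apply; apply: (@lt_le_trans _ _ (f c / 2 * e)).
    by rewrite mulr_gt0// divr_gt0.
  have {1}-> : e = c - (c - e) by ring.
  rewrite -itg_cst//; apply: le_itg; first exact: intg_cst.
    by apply: intg_sub PF.1; rewrite ?(ltW cb).
  move=> x /andP[cx xc].
  have := dP x c (le_trans acl cx) xc (ltW cb).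
  rewrite (gtr0_norm fc) => /(_ ltac:(lra)); rewrite ler_distl; lra.
- have ce : c <= c + e by lra.
  have FF := prim_diff PF (ltW ac) ce cbr.
  have := Fmin (c + e); rewrite cbr (le_trans (ltW ac) ce) -subr_ge0 FF// => /(_ isT).
  rewrite leNgt => /negP; apply; apply: (@le_lt_trans _ _ (f c / 2 * e)); last first.
    by rewrite nmulr_rlt0// ltr_pdivrMr// mul0r.
  have {2}-> : e = (c + e) - c by ring.
  rewrite -itg_cst//; apply: le_itg; [|exact: intg_cst|].
    by apply: intg_sub PF.1; rewrite ?(ltW ac).
  move=> x /andP[cx xc].
  have := dP c x (ltW ac) cx (le_trans xc cbr).
  rewrite (ltr0_norm fc) => /(_ ltac:(lra)); rewrite ler_distl; lra.
- by rewrite -fc eqxx in fc0.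
Qed.

Section Periodic.
Variable f : R -> R.
Hypothesis perf : periodic2pi f.

Lemma periodic_shiftE x : f (2 * pi + x) = f x.
Proof. by rewrite addrC perf. Qed.

Lemma intg_periodic : intg 0 (2 * pi) f -> intg 0 (4 * pi) f.
Proof.
move=> fi; apply: (@intg_cat _ _ (2 * pi)) => //; [pi_lra R|pi_lra R|].
have : intg (2 * pi) (4 * pi) (fun x => f (- (2 * pi) + x)).
  apply: intg_shift; have -> : - (2 * pi) + 2 * pi = 0 :> R by ring.
  by have -> : - (2 * pi) + 4 * pi = 2 * pi :> R by ring.
by apply: eq_intg => x _; rewrite -perf; congr f; ring.
Qed.

Lemma itg_periodic c : intg 0 (2 * pi) f -> 0 <= c <= 2 * pi ->
  itg 0 (2 * pi) (fun x => f (c + x)) = itg 0 (2 * pi) f.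
Proof.
move=> fi /andP[c0 c2]; have fi4 := intg_periodic fi.
have sub a b : 0 <= a -> b <= 4 * pi -> intg a b f.
  by move=> a0 b4; exact: intg_sub fi4.
rewrite itg_shift; last by apply: sub; pi_lra R.
rewrite addr0 (@itg_cat _ c (2 * pi)) ?(@itg_cat _ 0 c (2 * pi))//; [|pi_lra R|apply: sub; pi_lra R].
rewrite addrC; congr (_ + _).
have -> : c + 2 * pi = 2 * pi + c by ring.
have {1}-> : 2 * pi = 2 * pi + 0 :> R by ring.
rewrite -itg_shift; last by apply: sub; pi_lra R.
by apply: eq_itg => x _; exact: periodic_shiftE.
Qed.

Lemma intg_periodic_shift c : intg 0 (2 * pi) f -> 0 <= c <= 2 * pi ->
  intg 0 (2 * pi) (fun x => f (c + x)).
Proof.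
by move=> fi c02; apply: intg_shift; apply: intg_sub (intg_periodic fi); pi_lra R.
Qed.

End Periodic.

Lemma prim_periodic F f : periodic2pi F -> periodic2pi f ->
  prim 0 (2 * pi) F f -> prim 0 (4 * pi) F f.
Proof.
move=> perF perf PF; apply: (@prim_cat _ _ (2 * pi)) => //; [pi_lra R|pi_lra R|].
have : prim (2 * pi) (4 * pi) (fun x => F (- (2 * pi) + x)) (fun x => f (- (2 * pi) + x)).
  apply: prim_shift; have -> : - (2 * pi) + 2 * pi = 0 :> R by ring.
  by have -> : - (2 * pi) + 4 * pi = 2 * pi :> R by ring.
by apply: eq_prim => x _; rewrite -1?perF -1?perf; congr (_ _); ring.
Qed.

(** The working form of H^2: a function with absolutely continuous first derivative [p] and square
    integrable second derivative [g]. Pointwise periodicity of all three lets rotations act on the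
    data. *)
Definition H2_triple u p g :=
  [/\ periodic2pi u, periodic2pi p & periodic2pi g] /\
  [/\ prim 0 (2 * pi) u p, prim 0 (2 * pi) p g & intg 0 (2 * pi) (fun x => g x ^+ 2)].

Definition energy u p g := itg 0 (2 * pi) (eform u p g).

Lemma eform_intg u p g : H2_triple u p g -> intg 0 (2 * pi) (eform u p g).
Proof.
move=> [_ [pu pp gi]]; have h : 0 <= 2 * pi :> R by pi_lra R.
have i1 := intgM (prim_cont h pp) (intg_cont (prim_cont h pp)).
have i0 := intgM (prim_cont h pu) (intg_cont (prim_cont h pu)).
by apply: eq_intg (intgD (intgB gi (intgZ 10 i1)) (intgZ 9 i0)).
Qed.

Section Shifted.
Variables u p g : R -> R.
Hypothesis upg : H2_triple u p g.
Variable c : R.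
Hypothesis c02 : 0 <= c <= 2 * pi.

Lemma shift_triple : H2_triple (fun x => u (c + x)) (fun x => p (c + x)) (fun x => g (c + x)).
Proof.
have [[peru perp perg] [pu pp gi]] := upg; have /andP[c0 c2] := c02.
split; first by split=> x; rewrite addrA ?peru ?perp ?perg.
have h1 : 0 <= c + 0 by rewrite addr0.
have h2 : c + 2 * pi <= 4 * pi by pi_lra R.
split; try apply: prim_shift.
- exact: prim_sub (prim_periodic peru perp pu).
- exact: prim_sub (prim_periodic perp perg pp).
- apply: (@intg_periodic_shift (fun x => g x ^+ 2)) => // x.
  by rewrite perg.
Qed.

Lemma energy_shift :
  energy (fun x => u (c + x)) (fun x => p (c + x)) (fun x => g (c + x)) = energy u p g.
Proof.
have [[peru perp perg] _] := upg.
rewrite -[RHS](itg_periodic (c := c) _ (eform_intg upg))//.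
by move=> x; rewrite /eform peru perp perg.
Qed.

End Shifted.

(** Fermat's rule asks for an interior minimum. The sum [u x + u (x + pi)] has period [pi], so a
    minimum point over [[0, 3 pi]] can be moved by [pi] into [[pi, 2 pi]]. *)
Lemma crit_point u p g : H2_triple u p g -> exists c,
  [/\ 0 <= c <= 2 * pi, p c + p (c + pi) = 0 &
    forall x, 0 <= x <= 2 * pi -> u c + u (c + pi) <= u (c + x) + u (c + x + pi)].
Proof.
move=> [[peru perp perg] [pu pp gi]].
have pu4 := prim_periodic peru perp pu.
have pp4 := prim_periodic perp perg pp.
have piC x : u (x + pi + pi) = u x by rewrite -[RHS]peru; congr u; ring.
have sh F f : prim 0 (4 * pi) F f ->
    prim 0 (3 * pi) (fun x => F x + F (x + pi)) (fun x => f x + f (x + pi)).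
  move=> PF; apply: primD; first by apply: prim_sub PF; pi_lra R.
  have : prim 0 (3 * pi) (fun x => F (pi + x)) (fun x => f (pi + x)).
    by apply: prim_shift; apply: prim_sub PF; pi_lra R.
  by apply: eq_prim => x _; rewrite addrC.
have Pf := sh _ _ pu4; have Ph := sh _ _ pp4.
pose f x := u x + u (x + pi).
have h3 : 0 <= 3 * pi :> R by pi_lra R.
have [c0 c0in cmin] := EVT_min h3 (prim_cont h3 Pf).
have fpi x : f (x + pi) = f x by rewrite /f piC addrC.
have {}cmin x : 0 <= x <= 3 * pi -> f c0 <= f x.
  by move=> x3; apply: cmin; rewrite in_itv.
have [c [c1 c2 fc]] : exists c, [/\ pi <= c, c <= 2 * pi & f c = f c0].
  move: c0in; rewrite in_itv/= => /andP[c00 c03].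
  case: (leP c0 pi) => cpi.
    by exists (c0 + pi); split; [pi_lra R|pi_lra R|exact: fpi].
  case: (leP c0 (2 * pi)) => c2pi; first by exists c0; split => //; exact: ltW.
  exists (c0 - pi); split; [pi_lra R|pi_lra R|].
  by rewrite -[LHS]fpi subrK.
have fmin x : 0 <= x <= 3 * pi -> f c <= f x by move=> /cmin; rewrite fc.
exists c; split; [pi_lra R| |].
  by apply: (prim_crit Pf Ph) => //; pi_lra R.
move=> x /andP[x0 x2]; have [xs|xs] := leP (c + x) (3 * pi).
  by apply: fmin; pi_lra R.
have -> : u (c + x) + u (c + x + pi) = f (c + x - pi).
  by rewrite -fpi subrK.
by apply: fmin; pi_lra R.
Qed.

Lemma energy_ge u p g c : H2_triple u p g -> 0 <= c <= 2 * pi ->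
  p c + p (c + pi) = 0 ->
  12 * (u c + u (c + pi)) * (u (c + pi / 2) + u (c + (pi + pi / 2))) <= energy u p g.
Proof.
move=> upg c02 pc; rewrite -(energy_shift upg c02).
have [[v1 v2 v3] [w1 w2 w3]] := shift_triple upg c02.
have := @circle_energy_ge _ _ _ _ ((u c + u (c + pi)) / 2) w1 w2 w3.
rewrite !addr0 => H.
have -> : 12 * (u c + u (c + pi)) = 24 * ((u c + u (c + pi)) / 2) by field.
have [[peru perp _] _] := upg.
by apply: H => //; rewrite ?peru ?perp//; field.
Qed.

Lemma cont_powR u r : continuous u -> (forall x, 0 < u x) ->
  continuous (fun x => u x `^ r).
Proof.
move=> cu u0 x; apply: (@continuous_comp _ _ _ u (fun y => y `^ r)); first exact: cu.
apply/differentiable_continuous/derivable1_diffP/derivable_powR.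
by rewrite in_itv/= u0.
Qed.

Lemma intg_continuous a b f : continuous f -> intg a b f.
Proof. by move=> cf; apply/intg_cont/continuous_subspaceT. Qed.

(* Near the critical point [u <= 6 m] as long as [sin t ^ 3 <= m ^ 2 / E], and that
   interval alone makes the integral of [u ^ (- 2 / 3)] large enough. *)
Theorem energy_lower_bound u p g : H2_triple u p g -> continuous u ->
  (forall x, 0 < u x) ->
  36^-1 <= energy u p g * itg 0 (2 * pi) (fun x => u x `^ (- (2 / 3))) ^+ 3.
Proof.
move=> upg cu u0; have pi2 := pi_ge2 R; have [c [c02 pc cmin]] := crit_point upg.
have [[peru perp perg] _] := upg.
set m := (u c + u (c + pi)) / 2.
have m0 : 0 < m by rewrite divr_gt0// addr_gt0.
set E := energy u p g.
set U := u (c + pi / 2) + u (c + (pi + pi / 2)).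
have mU : 2 * m <= U.
  have := cmin (pi / 2) ltac:(lra); rewrite /U /m.
  have -> : c + pi / 2 + pi = c + (pi + pi / 2) by ring.
  by rewrite [2 * _]mulrC mulfVK.
have EU : 24 * m * U <= E.
  have := energy_ge upg c02 pc; rewrite -/U -/E; apply: le_trans.
  by rewrite le_eqVlt; apply/orP; left; apply/eqP; rewrite /m; field.
have mm0 : 0 < m ^+ 2 by rewrite exprn_gt0.
have Em : 48 * m ^+ 2 <= E.
  apply: le_trans EU; rewrite (_ : 48 * m ^+ 2 = 24 * m * (2 * m)); last by ring.
  by rewrite ler_wpM2l// mulr_ge0// ltW.
have E0 : 0 < E by apply: lt_le_trans Em; rewrite mulr_gt0.
(* Since [sin t <= t], this length ensures [sin t ^ 3 * E <= m ^ 2] for [t <= sg]; [E >= 48 m ^ 2]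
   keeps it below 1, hence inside the first quarter. *)
pose sg := (m ^+ 2 / E) `^ 3^-1.
have sg3 : sg ^+ 3 = m ^+ 2 / E.
  rewrite -powR_mulrn ?powR_ge0// -powRrM mulVf// powRr1//.
  by apply: divr_ge0; exact: ltW.
have sg0 : 0 < sg by rewrite powR_gt0// divr_gt0.
have sg1 : sg <= 1.
  rewrite leNgt; apply/negP => s1.
  have : 1 < sg ^+ 3 by rewrite exprn_egt1.
  rewrite sg3 ltr_pdivlMr// mul1r; lra.
pose v x := u (c + x).
have bound t : 0 <= t <= sg -> v t <= 6 * m.
  move=> /andP[]; rewrite le_eqVlt => /predU1P[<- _|t0 ts].
    by rewrite /v addr0; have := u0 (c + pi); rewrite /m; have := u0 c; lra.
  have t02 : 0 < t <= pi / 2 by lra.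
  have [_ [w1 w2 w3]] := shift_triple upg c02.
  (* The Young weight is [m]. The four terms on the right are then at most [4 m], [m / 12],
     [2 m / 3] and [m / 2], whose sum is below [6 m]. *)
  have := circle_bound w1 w2 w3 (m := m) _ _ _ _ m0 t02.
  rewrite -/(energy _ _ _) energy_shift// -/E -/U !addr0.
  rewrite ?peru ?perp => /(_ erefl erefl _ pc).
  have -> : u c + u (c + pi) = 2 * m by rewrite /m; field.
  move=> /(_ erefl) H.
  have vt : v t <= u (c + t) + u (c + (pi - t)) + u (c + (pi + t)) + u (c + (2 * pi - t)).
    have := u0 (c + (pi - t)); have := u0 (c + (pi + t)).
    by have := u0 (c + (2 * pi - t)); rewrite /v; lra.
  apply: le_trans vt (le_trans H _).
  have c1 : cos t ^+ 3 <= 1.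
    have c0 : 0 <= cos t by apply: cos_ge0_pihalf; lra.
    by rewrite exprn_ile1// cos_le1.
  have s0 : 0 <= sin t by rewrite sin_ge0_pi//; lra.
  have s3 : sin t ^+ 3 <= m ^+ 2 / E.
    rewrite -sg3 lerXn2r ?nnegrE ?(ltW sg0)//.
    by apply: le_trans ts; apply: sin_le; exact: ltW.
  have s30 : 0 <= sin t ^+ 3 by exact: exprn_ge0.
  set S := sin t ^+ 3 in s3 s30 *; set C := cos t ^+ 3 in c1 *.
  have sE : S * E <= m ^+ 2 by rewrite -ler_pdivlMr.
  have U0 : 0 <= U by apply: le_trans mU; rewrite mulr_ge0// ltW.
  have mU0 : 0 <= 24 * m * U by rewrite mulr_ge0// mulr_ge0// ltW.
  have sU : S * U <= m / 24.
    rewrite ler_pdivlMr// -(ler_pM2r m0) -expr2.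
    apply: (le_trans _ sE); rewrite (_ : S * U * 24 * m = S * (24 * m * U)); last by ring.
    by rewrite ler_wpM2l.
  have mC : m * C <= m by rewrite ler_piMr// ltW.
  have hX : S / (2 * m) * (E - 24 * m * U) <= m / 2.
    have m20 : 0 < 2 * m by lra.
    rewrite mulrAC ler_pdivrMr//.
    rewrite (_ : m / 2 * (2 * m) = m ^+ 2); last by field.
    apply: (le_trans _ sE); rewrite ler_wpM2l//; lra.
  move: (S / (2 * m) * _) hX => X hX; move: mC sU; lra.
have cp := @cont_powR u (- (2 / 3)) cu u0.
set I := itg _ _ _.
have I1 : sg * (6 * m) `^ (- (2 / 3)) <= I.
  rewrite /I -(@itg_periodic _ _ c)//; last 2 first.
  - by move=> x; rewrite peru.
  - exact: intg_continuous.
  have cpv : continuous (fun x => v x `^ (- (2 / 3))).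
    apply: cont_powR => [x|x]; last exact: u0.
    apply: continuous_comp; last exact: cu.
    by apply: cvgD; [exact: cvg_cst|exact: cvg_id].
  rewrite (@itg_cat _ 0 sg)//; [|exact: ltW|lra|exact: intg_continuous].
  rewrite -[leLHS]addr0 lerD//; last first.
    by apply: itg_ge0 => x _; exact: powR_ge0.
  have {1}-> : sg = sg - 0 by rewrite subr0.
  rewrite mulrC -itg_cst ?(ltW sg0)//.
  apply: le_itg; [exact: intg_cst|exact: intg_continuous|].
  have v0 x : 0 < v x by exact: u0.
  have m6 : 0 < 6 * m by lra.
  move=> x xs; rewrite !powRN lef_pV2 ?posrE ?powR_gt0//.
  by apply: ge0_ler_powR; rewrite ?nnegrE ?divr_ge0// ?bound// ltW.
have P0 : 0 <= (6 * m) `^ (- (2 / 3)) by exact: powR_ge0.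
have I3 : sg ^+ 3 * ((6 * m) `^ (- (2 / 3))) ^+ 3 <= I ^+ 3.
  rewrite -exprMn lerXn2r// nnegrE ?mulr_ge0 ?(ltW sg0)//.
  by apply: le_trans I1; rewrite mulr_ge0// ltW.
(* Here the exponent - 2 / 3 matters: the cube of [(6 m) ^ (- 2 / 3)] is [1 / (36 m ^ 2)], and the
   factor [m ^ 2 / E] from [sg ^ 3] cancels both [m] and [E]. *)
have -> : 36^-1 = E * (sg ^+ 3 * ((6 * m) `^ (- (2 / 3))) ^+ 3).
  have -> : (6 * m) `^ (- (2 / 3)) ^+ 3 = (6 * m) ^- 2.
    rewrite -(powR_mulrn 3 P0) -powRrM mulNr mulfVK//.
    by rewrite powR_invn// mulr_ge0// ltW.
  by rewrite sg3; field; rewrite !gt_eqF.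
by rewrite ler_wpM2l// ltW.
Qed.

End LowerBound.

(** * Trigonometric polynomials as test functions and as approximate indicators *)

Section TrigonometricPolynomials.
Variable R : realType.
Local Notation mu := (@lebesgue_measure R).
Implicit Types (a b c x y : R) (f g h phi psi : R -> R).

(** The free phase [b] covers sines as well; differentiation and integration only shift it by
    [pi / 2]. *)
Inductive trig : (R -> R) -> Prop :=
| trig_cos a n b : trig (fun x => a * cos (n%:R * x + b))
| trigD f g : trig f -> trig g -> trig (fun x => f x + g x).

Lemma trig_cst a : trig (fun=> a).
Proof.
have -> : (fun=> a) = (fun x => a * cos (0%:R * x + 0)).
  by apply/funext => x; rewrite mul0r addr0 cos0 mulr1.
exact: trig_cos.
Qed.

Lemma trigM f g : trig f -> trig g -> trig (fun x => f x * g x).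
Proof.
have prod a n b a' n' b' : (n' <= n)%N ->
    trig (fun x => (a * cos (n%:R * x + b)) * (a' * cos (n'%:R * x + b'))).
  move=> nn.
  have -> : (fun x => (a * cos (n%:R * x + b)) * (a' * cos (n'%:R * x + b'))) =
      (fun x => a * a' / 2 * cos ((n + n')%:R * x + (b + b'))
              + a * a' / 2 * cos ((n - n')%:R * x + (b - b'))).
    apply/funext => x; rewrite natrD natrB//.
    have -> : (n%:R + n'%:R) * x + (b + b') = (n%:R * x + b) + (n'%:R * x + b') by ring.
    have -> : (n%:R - n'%:R) * x + (b - b') = (n%:R * x + b) - (n'%:R * x + b') by ring.
    move: (n%:R * x + b) (n'%:R * x + b') => A B.
    by rewrite cosD cosB; field.
  by apply: trigD; exact: trig_cos.
move=> tf tg; elim: tf => [a n b|f1 f2 _ IH1 _ IH2]; last first.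
  have -> : (fun x => (f1 x + f2 x) * g x) = (fun x => f1 x * g x + f2 x * g x).
    by apply/funext => x; rewrite mulrDl.
  exact: trigD.
elim: tg => [a' n' b'|g1 g2 _ IH1 _ IH2]; last first.
  have -> : (fun x => a * cos (n%:R * x + b) * (g1 x + g2 x)) =
      (fun x => a * cos (n%:R * x + b) * g1 x + a * cos (n%:R * x + b) * g2 x).
    by apply/funext => x; rewrite mulrDr.
  exact: trigD.
case/orP: (leq_total n' n) => nn; first exact: prod.
have := prod a' n' b' a n b nn; congr trig.
by apply/funext => x; rewrite mulrC.
Qed.

Lemma trigX f n : trig f -> trig (fun x => f x ^+ n).
Proof.
move=> tf; elim: n => [|n IH]; first exact: trig_cst.
have -> : (fun x => f x ^+ n.+1) = (fun x => f x * f x ^+ n).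
  by apply/funext => x; rewrite exprS.
exact: trigM.
Qed.

Lemma trig_deriv f : trig f -> exists2 f', trig f' & forall x, is_derive x 1 f (f' x).
Proof.
elim=> [a n b|f1 f2 _ [f1' t1 d1] _ [f2' t2 d2]]; last first.
  by exists (fun x => f1' x + f2' x); [exact: trigD|move=> x; exact: is_deriveD].
exists (fun x => (a * n%:R) * cos (n%:R * x + (b + pi / 2))).
  exact: trig_cos.
move=> x.
have d1 : is_derive x 1 (fun x => n%:R * x + b) (n%:R : R).
  have d0 : is_derive x 1 (fun x : R => n%:R *: x) (n%:R *: 1 : R).
    exact: is_deriveZ.
  apply: (is_derive_eq (is_deriveD d0 (is_derive_cst b x 1))).
  by rewrite addr0 /GRing.scale/= mulr1.
have d2 := @is_derive1_comp R cos (fun x => n%:R * x + b) x _ _ (is_derive_cos _) d1.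
apply: (is_derive_eq (is_deriveZ a d2)).
by rewrite addrA cosDpihalf /GRing.scale/=; ring.
Qed.

Lemma trig_cont f : trig f -> continuous f.
Proof. by move=> /trig_deriv[f' _ d] x; exact: derive_continuous (d x). Qed.

Lemma trig_periodic f : trig f -> periodic2pi f.
Proof.
elim=> [a n b x|f1 f2 _ IH1 _ IH2 x]; last by rewrite IH1 IH2.
congr (_ * _).
have -> : n%:R * (x + 2 * pi) + b = (n%:R * x + b) + (pi *+ 2) *+ n.
  by rewrite -mulrnA -[pi *+ _]mulr_natr natrM; ring.
by rewrite periodicn//; exact: cosD2pi.
Qed.

Lemma trig_derive1n f k : trig f -> trig (derive1n k f).
Proof.
move=> tf; elim: k => // k /trig_deriv[f' tf' d].
rewrite derive1nS; suff -> : derive1 (derive1n k f) = f' by [].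
by apply/funext => x; rewrite derive1E; exact: derive_val.
Qed.

Lemma trig_test f : trig f -> test_function f.
Proof.
move=> tf; split; first exact: trig_periodic.
move=> k x; have [f' _ d] := trig_deriv (trig_derive1n k tf).
exact: ex_derive.
Qed.

(** Every frequency except 0 has a periodic antiderivative; [c] collects the terms of frequency
    0. *)
Lemma trig_antideriv f : trig f -> exists c, exists2 phi, trig phi &
  forall x, is_derive x 1 phi (f x - c).
Proof.
elim=> [a n b|f1 f2 _ [c1 [p1 t1 d1]] _ [c2 [p2 t2 d2]]]; last first.
  exists (c1 + c2); exists (fun x => p1 x + p2 x); first exact: trigD.
  move=> x; apply: (is_derive_eq (is_deriveD (d1 x) (d2 x))).
  by ring.
case: n => [|n].
  exists (a * cos b); exists (fun=> 0); first exact: trig_cst.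
  move=> x; rewrite mul0r add0r subrr; exact: is_derive_cst.
exists 0; exists (fun x => (a / n.+1%:R) * cos (n.+1%:R * x + (b - pi / 2))).
  exact: trig_cos.
move=> x.
have d1 : is_derive x 1 (fun x => n.+1%:R * x + (b - pi / 2)) (n.+1%:R : R).
  have d0 : is_derive x 1 (fun x : R => n.+1%:R *: x) (n.+1%:R *: 1 : R).
    exact: is_deriveZ.
  apply: (is_derive_eq (is_deriveD d0 (is_derive_cst (b - pi / 2) x 1))).
  by rewrite addr0 /GRing.scale/= mulr1.
have d2 := @is_derive1_comp R cos (fun x => n.+1%:R * x + (b - pi / 2)) x _ _ (is_derive_cos _) d1.
apply: (is_derive_eq (is_deriveZ (a / n.+1%:R) d2)).
rewrite addrA sinBpihalf subr0 /GRing.scale/=.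
by field; rewrite addrC natr1 pnatr_eq0.
Qed.

(* [(1 - y ^ n) ^ N] with [N] about [tau ^ - n] tends to 1 where [y < tau] and
   to 0 where [y > tau]. *)
Definition step (tau : R) n (y : R) : R := (1 - y ^+ n) ^+ (Num.truncn (tau ^- n)).+1.

Lemma bernoulli_ge (z : R) n : -1 <= z -> 1 + n%:R * z <= (1 + z) ^+ n.
Proof.
move=> z1; elim: n => [|n IH]; first by rewrite mul0r addr0 expr0.
rewrite exprS; have z0 : 0 <= 1 + z by lra.
apply: (@le_trans _ _ ((1 + z) * (1 + n%:R * z))); last by rewrite ler_wpM2l.
rewrite -natr1 -subr_ge0.
have -> : (1 + z) * (1 + n%:R * z) - (1 + (n%:R + 1) * z) = n%:R * z ^+ 2 by ring.
by rewrite mulr_ge0// sqr_ge0.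
Qed.

Lemma step_bnd (tau : R) n (y : R) : 0 <= y <= 1 -> 0 <= step tau n y <= 1.
Proof.
move=> /andP[y0 y1]; have h0 : 0 <= 1 - y ^+ n by rewrite subr_ge0 exprn_ile1.
by rewrite exprn_ge0//= exprn_ile1// gerBl exprn_ge0.
Qed.

(** Bernoulli's inequality bounds the step below by [1 - N y ^ n], and rounding up costs at most a
    factor 2, because [tau ^- n >= 1]. *)
Lemma step_lt (tau y : R) : 0 < tau < 1 -> 0 <= y < tau -> step tau n y @[n --> \oo] --> (1 : R).
Proof.
move=> /andP[t0 t1] /andP[y0 yt].
have rlt : `|y / tau| < 1.
  by rewrite ger0_norm ?divr_ge0 ?(ltW t0)// ltr_pdivrMr// mul1r.
have c1 : (1 - 2 * (y / tau) ^+ n) @[n --> \oo] --> (1 : R).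
  rewrite -[X in _ --> X]subr0 -[X in _ - X](mulr0 2).
  by apply: cvgB; [exact: cvg_cst|apply: cvgM; [exact: cvg_cst|exact: cvg_expr]].
apply: (@squeeze_cvgr _ _ _ _ (fun n => 1 - 2 * (y / tau) ^+ n) (fun=> 1)) => //; last exact: cvg_cst.
apply: nearW => n.
have y1 : y <= 1 by rewrite ltW// (lt_trans yt).
have /andP[_ ->] : 0 <= step tau n y <= 1 by apply: step_bnd; rewrite y0.
rewrite andbT; set N := (Num.truncn (tau ^- n)).+1.
have tn0 : 0 < tau ^+ n by exact: exprn_gt0.
have yn : y ^+ n <= 1 by exact: exprn_ile1.
have := @bernoulli_ge (- y ^+ n) N; rewrite lerN2 => /(_ yn); apply: le_trans.
rewrite mulrN lerD2l lerN2.
have N2 : N%:R <= 2 * tau ^- n :> R.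
  have /truncn_itv/andP[tr _] : 0 <= tau ^- n by rewrite invr_ge0 ltW.
  rewrite /N -natr1; have : 1 <= tau ^- n.
    by rewrite invf_ge1// exprn_ile1// ltW.
  by lra.
by rewrite expr_div_n [_ ^+ n / _]mulrC mulrA ler_wpM2r// exprn_ge0.
Qed.

(** [(1 - y ^ n) ^ N (1 + y ^ n) ^ N <= 1], and by Bernoulli the second factor is at least
    [N y ^ n >= (y / tau) ^ n]. *)
Lemma step_gt (tau y : R) : 0 < tau -> tau < y <= 1 -> step tau n y @[n --> \oo] --> (0 : R).
Proof.
move=> t0 /andP[ty y1]; have y0 := lt_trans t0 ty.
have rlt : `|tau / y| < 1.
  by rewrite ger0_norm ?divr_ge0 ?(ltW t0) ?(ltW y0)// ltr_pdivrMr// mul1r.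
apply: (@squeeze_cvgr _ _ _ _ (fun=> 0) (fun n => (tau / y) ^+ n)); [|exact: cvg_cst|exact: cvg_expr].
apply: nearW => n.
have /andP[s0 s1] : 0 <= step tau n y <= 1 by apply: step_bnd; rewrite (ltW y0).
rewrite s0/=; rewrite /step in s0 s1 *; set N := (Num.truncn (tau ^- n)).+1 in s0 s1 *.
have tn0 : 0 < tau ^+ n by exact: exprn_gt0.
have yn0 : 0 < y ^+ n by exact: exprn_gt0.
have yn : y ^+ n <= 1 by rewrite exprn_ile1// ltW.
have tN : tau ^- n <= N%:R.
  have : 0 <= tau ^- n by rewrite invr_ge0 ltW.
  by move=> /truncn_itv/andP[_ /ltW].
have B := @bernoulli_ge (y ^+ n) N (le_trans (lerN10 _) (ltW yn0)).
have B1 : tau ^- n * y ^+ n <= (1 + y ^+ n) ^+ N.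
  apply: le_trans B; apply: (@le_trans _ _ (N%:R * y ^+ n)); last by rewrite lerDr.
  by rewrite ler_wpM2r// ltW.
have prod1 : (1 - y ^+ n) ^+ N * (1 + y ^+ n) ^+ N <= 1.
  rewrite -exprMn; apply: exprn_ile1; last by rewrite -subr_sqr expr1n gerBl sqr_ge0.
  by rewrite mulr_ge0 ?subr_ge0// addr_ge0// ltW.
have q0 : 0 < tau ^- n * y ^+ n by rewrite mulr_gt0// invr_gt0.
rewrite expr_div_n (_ : tau ^+ n / y ^+ n = (tau ^- n * y ^+ n)^-1); last first.
  by rewrite invfM invrK mulrC mulrC.
by rewrite -[leRHS]mul1r ler_pdivlMr// (le_trans _ prod1)// ler_wpM2l.
Qed.

End TrigonometricPolynomials.

(** * Integrable functions orthogonal to all trigonometric polynomials *)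

Section WeakDerivatives.
Variable R : realType.
Local Notation mu := (@lebesgue_measure R).
Implicit Types (a b c x y : R) (f g h k u p phi psi F : R -> R).

Lemma circleE x : circle x = (0 <= x <= 2 * pi) :> Prop.
Proof. by rewrite /circle /= in_itv. Qed.

Definition eq_on_circle f g := {ae mu, forall x, circle x -> f x = g x}.

Lemma eq_on_circle_itg f g :
  measurable_fun (@circle R) f -> measurable_fun (@circle R) g -> eq_on_circle f g ->
  itg 0 (2 * pi) f = itg 0 (2 * pi) g.
Proof.
move=> mf mg fg; congr fine; apply: ae_eq_integral => //.
- exact/measurable_EFinP.
- exact/measurable_EFinP.
- apply: (@filterS _ _ (ae_filter_ringOfSetsType mu) _ _ _ fg).
  by move=> x H cx; rewrite /= H.
Qed.

Lemma trig_step (tau c : R) n : trig (fun x => step tau n ((1 - cos (x - c)) / 2)).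
Proof.
rewrite /step; apply: trigX.
have -> : (fun x => 1 - ((1 - cos (x - c)) / 2) ^+ n) =
    (fun x => 1 + (- 1) * (2^-1 + (- 2^-1) * cos (1%:R * x + - c)) ^+ n).
  apply/funext => x; rewrite mul1r mulN1r; congr (1 - _ ^+ n); by field.
exact: (trigD (trig_cst 1) (trigM (trig_cst (- 1))
  (trigX n (trigD (trig_cst 2^-1) (trig_cos (- 2^-1) 1 (- c)))))).
Qed.

Lemma ae_off_points (P : R -> Prop) a b c :
  (forall x, x <> a -> x <> b -> x <> c -> P x) -> {ae mu, forall x, P x}.
Proof.
move=> H.
have N d : mu.-negligible [set d].
  by exists [set d]; split => //; exact: lebesgue_measure_set1.
apply: negligibleS (negligibleU (negligibleU (N a) (N b)) (N c)) => x /= nP.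
by apply: contrapT => /not_orP[/not_orP[xa xb] xc]; apply: nP; exact: H.
Qed.

(** The indicator of [[0, b]] is, off three points, the bounded limit of the trigonometric
    polynomials [phi n], so dominated convergence carries the orthogonality over to it. No density
    theorem in a space of continuous functions is involved. *)
Lemma trig_orth_itg h b : intg 0 (2 * pi) h ->
  (forall psi, trig psi -> itg 0 (2 * pi) (fun x => h x * psi x) = 0) ->
  0 <= b <= 2 * pi -> itg 0 b h = 0.
Proof.
move=> hi orth /andP[b0 b2].
move: b0; rewrite le_eqVlt => /predU1P[<-|b0]; first exact: itg_xx.
move: b2; rewrite le_eqVlt => /predU1P[->|b2].
  rewrite -[RHS](orth (fun=> 1) (trig_cst 1)).
  by apply: eq_itg => x _; rewrite mulr1.
(* [y] is the squared sine of half the distance to the midpoint [b / 2], and [tau] is its value at 0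
   and at [b]; the factorization [ydiff] shows that [y < tau] on the arc between them and [y > tau]
   on the complementary open arc. *)
pose tau := (1 - cos (b / 2)) / 2.
pose y x := (1 - cos (x - b / 2)) / 2.
have y01 x : 0 <= y x <= 1.
  by rewrite /y; have := cos_le1 (x - b / 2); have := cos_geN1 (x - b / 2); lra.
have ydiff x : y x - tau = - (sin (x / 2) * sin ((b - x) / 2)).
  rewrite /y /tau.
  have -> : x - b / 2 = x / 2 - (b - x) / 2 by field.
  have -> : b / 2 = x / 2 + (b - x) / 2 by field.
  by rewrite cosB cosD; field.
have tau01 : 0 < tau < 1.
  have b2pi : 0 < b / 2 < pi by pi_lra R.
  have cb : - 1 < cos (b / 2) < 1.
    have sb : 0 < sin (b / 2) by exact: sin_gt0_pi.
    have := cos2Dsin2 (b / 2); have : 0 < sin (b / 2) ^+ 2 by rewrite exprn_gt0.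
    by move=> s2 cs; rewrite -ltr_norml -(@expr_lt1 _ 2)// real_normK ?num_real//; lra.
  by rewrite /tau; lra.
have ylt x : 0 < x -> x < b -> 0 <= y x < tau.
  move=> x0 xb; have /andP[-> _]/= := y01 x.
  rewrite -subr_lt0 ydiff oppr_lt0 mulr_gt0// sin_gt0_pi//; pi_lra R.
have ygt x : b < x -> x < 2 * pi -> tau < y x <= 1.
  move=> x0 xb; have /andP[_ ->] := y01 x.
  rewrite andbT -subr_gt0 ydiff oppr_gt0 nmulr_llt0 ?sin_gt0_pi//; [pi_lra R|].
  have -> : (b - x) / 2 = - ((x - b) / 2) by field.
  by rewrite sinN oppr_lt0 sin_gt0_pi//; pi_lra R.
pose phi n x := step tau n (y x).
have tphi n : trig (phi n) by exact: trig_step.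
pose A : set R := [set` `[0, b[].
have mA : measurable A by exact: measurable_itv.
have mh := intg_measurable hi.
have hphi n : intg 0 (2 * pi) (fun x => h x * phi n x).
  have cphi : {within `[0, 2 * pi], continuous (phi n)}.
    exact/continuous_subspaceT/trig_cont.
  by apply: eq_intg (intgM cphi hi) => x _; rewrite mulrC.
pose hn n x := h x * phi n x.
have mhA : measurable_fun [set` `[0, 2 * pi]] (EFin \o (h \_ A)).
  apply/measurable_EFinP/measurable_restrict => //.
  by apply: (@measurable_funS _ _ _ _ [set` `[0, 2 * pi]]) => //; exact: subIsetl.
have lim_ae : {ae mu, forall x, [set` `[0, 2 * pi]] x ->
    (EFin \o hn n) x @[n --> \oo] --> (EFin \o (h \_ A)) x}.
  apply: (@ae_off_points _ 0 b (2 * pi)) => x x0 xb x2.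
  rewrite /= in_itv/= => /andP[x0' x2'].
  have {x0 x0'} x0 : 0 < x by rewrite lt_neqAle x0' andbT eq_sym; apply/eqP.
  have {x2 x2'} x2 : x < 2 * pi by rewrite lt_neqAle x2' andbT; apply/eqP.
  apply: cvg_EFin; first exact: nearW.
  case: (ltgtP x b) xb => // xb _.
    rewrite patchE mem_set; last by rewrite /A/= in_itv/= (ltW x0).
    rewrite -[X in _ --> X]mulr1; apply: cvgM; first exact: cvg_cst.
    by apply: step_lt => //; exact: ylt.
  rewrite patchE memNset; last by rewrite /A/= in_itv/= ltNge (ltW xb) andbF.
  rewrite -[X in _ --> X](mulr0 (h x)); apply: cvgM; first exact: cvg_cst.
  by apply: step_gt; [case/andP: tau01|exact: ygt].
have dom : {ae mu, forall x n, [set` `[0, 2 * pi]] x ->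
    (`|(EFin \o hn n) x| <= `|(h x)%:E|)%E}.
  apply: aeW => x n _; rewrite /= lee_fin normrM ler_piMr//.
  have /andP[s0 s1] := @step_bnd _ tau n _ (y01 x).
  by rewrite ger0_norm.
have [_ _] := @dominated_convergence _ _ _ mu [set` `[0, 2 * pi]] (measurable_itv _)
  (fun n => EFin \o hn n) (EFin \o (h \_ A)) (fun x => `|(h x)%:E|%E)
  (fun n => measurable_int _ (hphi n)) mhA lim_ae (integrable_abse hi) dom.
rewrite (_ : [sequence _]_n = (fun=> 0%E)); last first.
  apply/funext => n /=.
  have := orth _ (tphi n); rewrite /itg /Rintegral => H.
  rewrite -[LHS]fineK; first by rewrite H.
  by apply: integrable_fin_num => //; exact: hphi.
move=> /(cvg_unique (@ereal_hausdorff R) (cvg_cst 0%E)) I0.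
have : \int[mu]_(x in [set` `[0, 2 * pi]]) (h \_ A) x = 0.
  by rewrite /Rintegral -I0.
rewrite -Rintegral_mkcondr.
have -> : [set` `[0, 2 * pi]] `&` A = [set` `[0, b[].
  apply/seteqP; split=> x /=; rewrite /A /= !in_itv/=; first by case.
  by move=> /andP[x0 xb]; rewrite x0 xb (ltW (lt_trans xb b2)).
rewrite Rintegral_itv_bndo_bndc//.
apply: integrableS hi => //; apply: subset_itv; rewrite bnd_simp//; exact: ltW.
Qed.

(** All integrals from 0 vanish, so Lebesgue differentiation gives [h = 0] almost everywhere.
    Extending by zero and integrating from - 1 puts all of the circle strictly to the right of the
    base point. *)
Lemma trig_orth_ae0 h : intg 0 (2 * pi) h ->
  (forall psi, trig psi -> itg 0 (2 * pi) (fun x => h x * psi x) = 0) ->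
  eq_on_circle h (fun=> 0).
Proof.
move=> hi orth; have p2 : 0 <= 2 * pi :> R by pi_lra R.
have I0 b : 0 <= b <= 2 * pi -> itg 0 b h = 0 by exact: trig_orth_itg.
pose f := h \_ [set` `[0, 2 * pi]].
have floc : locally_integrable setT f by exact: integrable_locally_restrict.
have fi : mu.-integrable setT (EFin \o f).
  by rewrite -restrict_EFin; apply/integrable_restrict => //=; rewrite setTI.
have F0 y : \int[mu]_(t in [set` Interval (BLeft (- 1)) (BRight y)]) f t = 0.
  rewrite -Rintegral_mkcondr.
  have [y0|y0] := ltP y 0.
    rewrite (_ : _ `&` _ = set0) ?Rintegral_set0//.
    apply/seteqP; split=> x //=; rewrite !in_itv/= => -[/andP[_ xy] /andP[x0 _]].
    by have := lt_le_trans y0 (le_trans x0 xy); rewrite ltxx.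
  have -> : [set` Interval (BLeft (- 1)) (BRight y)] `&` [set` `[0, 2 * pi]] =
      [set` `[0, Num.min y (2 * pi)]].
    apply/seteqP; split=> x /=; rewrite !in_itv/= le_min.
      by move=> [/andP[_ ->] /andP[-> ->]].
    by move=> /and3P[x0 -> ->]; rewrite x0 (le_trans (lerN10 _) x0).
  by apply: I0; rewrite le_min y0 p2/= ge_min lexx orbT.
have fiy y : mu.-integrable [set` Interval (BLeft (- 1)) (BRight y)] (EFin \o f).
  by apply: integrableS fi.
have := @FTC1 R f (BLeft (- 1)) fiy floc.
apply: (@filterS _ _ (ae_filter_ringOfSetsType mu)) => x H.
rewrite circleE => /andP[x0 x2].
have [|_] := H.
  by rewrite /= lte_fin (lt_le_trans _ x0)// ltrN10.
under [X in derive1 X]funext do rewrite F0.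
rewrite derive1_cst /f patchE mem_set; first by move=> <-.
by rewrite /= in_itv/= x0.
Qed.

End WeakDerivatives.

(** * Weak derivatives and absolutely continuous representatives *)

Section Regularity.
Variable R : realType.
Local Notation mu := (@lebesgue_measure R).
Implicit Types (a b c x y : R) (f g h k u p phi psi F : R -> R).

Lemma cont_itg0 a b k : a < b -> {within `[a, b], continuous k} ->
  (forall x, a <= x <= b -> 0 <= k x) -> itg a b k = 0 ->
  forall x, a <= x <= b -> k x = 0.
Proof.
move=> ab ck k0 I0 x /andP[ax xb]; apply/eqP; apply/negPn/negP => kx0.
have kx : 0 < k x by rewrite lt_neqAle eq_sym kx0 k0// ax.
have ki : intg a b k by exact: intg_cont.
have e0 : 0 < k x / 2 by rewrite divr_gt0.
move/subspace_continuousP: ck => /(_ x); rewrite /= in_itv/= ax xb => /(_ isT).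
move=> /cvgrPdist_lt /(_ _ e0); rewrite near_withinE.
move=> /nbhs_ballP[d /= d0 dP].
have near_ge y : a <= y <= b -> `|x - y| < d -> k x / 2 <= k y.
  move=> yab xyd; have := dP y xyd; rewrite in_itv/= => /(_ yab).
  rewrite ltr_distlC => /andP[+ _]; rewrite (_ : k x - k x / 2 = k x / 2); last by field.
  exact: ltW.
have [c [c' [ac cc' c'b cP]]] : exists c c', [/\ a <= c, c < c', c' <= b &
    forall y, c <= y <= c' -> `|x - y| < d].
  have [xb'|xb'] := ltP x b.
    exists x, (Num.min b (x + d / 2)); split => //.
    - by rewrite lt_min xb' ltrDl divr_gt0.
    - by rewrite ge_min lexx.
    - move=> y; rewrite le_min => /and3P[xy _ yd].
      by rewrite ler0_norm ?subr_le0//; lra.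
  exists (Num.max a (x - d / 2)), x; split => //.
  - by rewrite le_max lexx.
  - by rewrite gt_max (lt_le_trans ab xb')/= gtrBl divr_gt0.
  - move=> y; rewrite ge_max => /andP[/andP[_ yd] yx].
    by rewrite ger0_norm ?subr_ge0//; lra.
have cb : c <= b by rewrite (le_trans (ltW cc')).
have ac' : a <= c' by rewrite (le_trans ac)// ltW.
have pos : 0 < itg c c' k.
  apply: (@lt_le_trans _ _ (itg c c' (fun=> k x / 2))).
    by rewrite itg_cst ?ltW// mulr_gt0// subr_gt0.
  apply: le_itg; [exact: intg_cst|exact: intg_sub ki|].
  move=> y /andP[cy yc']; apply: near_ge; last by apply: cP; rewrite cy.
  by rewrite (le_trans ac cy) (le_trans yc' c'b).
have : itg c c' k <= 0.
  rewrite -I0 (@itg_cat _ a c b)// (@itg_cat _ c c' b) ?(ltW cc')//; last exact: intg_sub ki.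
  rewrite addrCA lerDl addr_ge0//; apply: itg_ge0 => y /andP[y1 y2]; apply: k0.
    by rewrite y1 (le_trans y2).
  by rewrite y2 (le_trans ac').
by rewrite leNgt pos.
Qed.

Lemma cont_eq_on_circle f g :
  {within `[0, 2 * pi], continuous f} -> {within `[0, 2 * pi], continuous g} ->
  eq_on_circle f g -> forall x, 0 <= x <= 2 * pi -> f x = g x.
Proof.
move=> cf cg fg x x2; have p2 : 0 < 2 * pi :> R by pi_lra R.
pose k y := `|f y - g y|.
have ck : {within `[0, 2 * pi], continuous k}.
  move=> y; apply: cvg_norm; apply: cvgB; [exact: cf|exact: cg].
have I0 : itg 0 (2 * pi) k = 0.
  rewrite (@eq_on_circle_itg _ k (fun=> 0)) ?itg_cst ?mul0r ?(ltW p2)//.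
  - exact: intg_measurable (intg_cont ck).
  - apply: (@filterS _ _ (ae_filter_ringOfSetsType mu) _ _ _ fg) => y H cy.
    by rewrite /k H// subrr normr0.
have k0 y : 0 <= y <= 2 * pi -> 0 <= k y by move=> _; exact: normr_ge0.
have /eqP := cont_itg0 p2 ck k0 I0 x2.
by rewrite normr_eq0 subr_eq0 => /eqP.
Qed.

(** The du Bois-Reymond lemma. The test function 1 gives [g] mean zero, so [G] vanishes at both ends
    and [K = f - G] is orthogonal to every derivative [phi']. Any [psi] is such a [phi'] plus a
    constant, and [K] minus its mean [C] is orthogonal to constants too. *)
Lemma weak_primitive f g : intg 0 (2 * pi) f -> intg 0 (2 * pi) g ->
  (forall phi phi', trig phi -> trig phi' -> (forall x, is_derive x 1 phi (phi' x)) ->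
    itg 0 (2 * pi) (fun x => f x * phi' x) = - itg 0 (2 * pi) (fun x => g x * phi x)) ->
  itg 0 (2 * pi) g = 0 /\ exists c, eq_on_circle f (fun x => c + itg 0 x g).
Proof.
move=> fi gi weak; have p2 : 0 <= 2 * pi :> R by pi_lra R.
have g0 : itg 0 (2 * pi) g = 0.
  have := weak _ _ (trig_cst 1) (trig_cst 0) (fun x => is_derive_cst _ _ _).
  rewrite (@eq_itg _ _ _ _ (fun=> 0)); last by move=> x _; rewrite mulr0.
  rewrite itg_cst// mul0r => /eqP; rewrite eq_sym oppr_eq0 => /eqP H.
  by rewrite -[RHS]H; apply: eq_itg => x _; rewrite mulr1.
split=> //; pose G x := itg 0 x g.
have pG : prim 0 (2 * pi) G g by split=> // x _; rewrite /G itg_xx add0r.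
have Gi := intg_cont (prim_cont p2 pG).
pose K x := f x - G x.
have Ki : intg 0 (2 * pi) K by exact: intgB.
have KM psi : trig psi -> intg 0 (2 * pi) (fun x => K x * psi x).
  move=> tpsi; have cpsi : {within `[0, 2 * pi], continuous psi}.
    exact/continuous_subspaceT/trig_cont.
  by apply: eq_intg (intgM cpsi Ki) => x _; rewrite mulrC.
have orth phi phi' : trig phi -> trig phi' -> (forall x, is_derive x 1 phi (phi' x)) ->
    itg 0 (2 * pi) (fun x => K x * phi' x) = 0.
  move=> tp tp' D.
  have pp : prim 0 (2 * pi) phi phi' by apply: prim_derivable => //; exact: trig_cont.
  have pGp := primM p2 pG pp.
  have cphi := prim_cont p2 pp.
  have cphi' : {within `[0, 2 * pi], continuous phi'}.
    exact/continuous_subspaceT/trig_cont.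
  have i1 : intg 0 (2 * pi) (fun x => g x * phi x).
    by apply: eq_intg (intgM cphi gi) => x _; rewrite mulrC.
  have i2 : intg 0 (2 * pi) (fun x => G x * phi' x).
    by apply: eq_intg (intgM cphi' Gi) => x _; rewrite mulrC.
  have i3 : intg 0 (2 * pi) (fun x => f x * phi' x).
    by apply: eq_intg (intgM cphi' fi) => x _; rewrite mulrC.
  have := prim_itg p2 pGp; rewrite itgD// /G g0 itg_xx !mul0r subr0 => E.
  rewrite (@eq_itg _ _ _ _ (fun x => f x * phi' x - G x * phi' x)); last first.
    by move=> x _; rewrite /K mulrBl.
  by rewrite itgB// (weak _ _ tp tp' D) -opprD E oppr0.
pose C := itg 0 (2 * pi) K / (2 * pi).
exists C.
have p2n : 2 * pi != 0 :> R by rewrite gt_eqF//; pi_lra R.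
have : eq_on_circle (fun x => K x - C) (fun=> 0).
  apply: trig_orth_ae0; first by apply: intgB => //; exact: intg_cst.
  move=> psi tpsi; have [c [phi tphi D]] := trig_antideriv tpsi.
  pose phi' x := psi x - c.
  have tphi' : trig phi' by exact: (trigD tpsi (trig_cst (- c))).
  have O := orth _ _ tphi tphi' D.
  have pphi : prim 0 (2 * pi) phi phi' by apply: prim_derivable => //; exact: trig_cont.
  have I0 : itg 0 (2 * pi) phi' = 0.
    rewrite (prim_itg p2 pphi); have := trig_periodic tphi 0.
    by rewrite add0r => ->; rewrite subrr.
  rewrite (@eq_itg _ _ _ _ (fun x => (K x * phi' x - C * phi' x) + c * (K x - C))); last first.
    by move=> x _; rewrite /phi'; ring.
  have ip : intg 0 (2 * pi) phi' by exact: pphi.1.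
  have iK := KM _ tphi'.
  have iC : intg 0 (2 * pi) (fun=> C) by exact: intg_cst.
  have iB : intg 0 (2 * pi) (fun x => K x - C) by exact: intgB.
  have iCp : intg 0 (2 * pi) (fun x => C * phi' x) by exact: intgZ.
  rewrite itgD; [|exact: intgB|exact: intgZ].
  have J2 : itg 0 (2 * pi) (fun x => K x - C) = 0.
    by rewrite itgB// itg_cst// subr0 /C mulfVK// subrr.
  have J1 : itg 0 (2 * pi) (fun x => K x * phi' x - C * phi' x) = 0.
    by rewrite itgB// O (itgZ C ip) I0 mulr0 subr0.
  by rewrite J1 (itgZ c iB) J2 mulr0 addr0.
apply: (@filterS _ _ (ae_filter_ringOfSetsType mu)) => x H cx.
by have /eqP := H cx; rewrite /K subr_eq add0r subr_eq => /eqP.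
Qed.

Lemma periodic_extension f : f (2 * pi) = f 0 ->
  exists2 g, periodic2pi g & forall x, 0 <= x <= 2 * pi -> g x = f x.
Proof.
move=> f2; have p2 : 0 < 2 * pi :> R by pi_lra R.
exists (fun x => f (x - (Num.floor (x / (2 * pi)))%:~R * (2 * pi))) => [x|x /andP[x0]].
  have -> : (x + 2 * pi) / (2 * pi) = x / (2 * pi) + 1.
    by rewrite mulrDl divff// gt_eqF.
  by rewrite floorDrz ?rpred1// floor1 intrD; congr f; ring.
rewrite le_eqVlt => /predU1P[->|x2].
  by rewrite divff ?gt_eqF// floor1 mul1r subrr f2.
rewrite (_ : Num.floor _ = 0) ?mul0r ?subr0//.
apply: floor_def; rewrite add0r divr_ge0//= ?(ltW p2)//.
by rewrite ltr_pdivrMr// mul1r.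
Qed.

Lemma weak_unique (j : nat) f g g' : is_weak_derivative j f g -> is_weak_derivative j f g' ->
  eq_on_circle g g'.
Proof.
move=> [_ gi gw] [_ g'i g'w].
have gi_ : intg 0 (2 * pi) g by [].
have g'i_ : intg 0 (2 * pi) g' by [].
have : eq_on_circle (fun x => g x - g' x) (fun=> 0).
  apply: trig_orth_ae0; first exact: intgB.
  move=> psi tpsi.
  have cpsi : {within `[0, 2 * pi], continuous psi}.
    exact/continuous_subspaceT/trig_cont.
  have i1 : intg 0 (2 * pi) (fun x => g x * psi x).
    by apply: eq_intg (intgM cpsi gi_) => x _; rewrite mulrC.
  have i2 : intg 0 (2 * pi) (fun x => g' x * psi x).
    by apply: eq_intg (intgM cpsi g'i_) => x _; rewrite mulrC.
  rewrite (@eq_itg _ _ _ _ (fun x => g x * psi x - g' x * psi x)); last first.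
    by move=> x _; rewrite mulrBl.
  rewrite itgB//; apply/eqP; rewrite subr_eq0; apply/eqP.
  have := gw _ (trig_test tpsi); rewrite (g'w _ (trig_test tpsi)).
  by move=> /(mulrI (unitrX j (unitrN1 R))).
apply: (@filterS _ _ (ae_filter_ringOfSetsType mu)) => x H cx.
by have /eqP := H cx; rewrite subr_eq0 => /eqP.
Qed.

Lemma derive1n1E f f' : (forall x, is_derive x 1 f (f' x)) -> derive1n 1 f = f'.
Proof. by move=> D; apply/funext => x; rewrite /derive1n/= derive1E; exact: derive_val. Qed.

(** The du Bois-Reymond lemma is applied to [g1], [g2] and then to [u], [g1]. The primitive of [g2]
    has equal end values because [g2] has mean zero, so it extends to the periodic [p]; continuity
    of [u] turns the second identity, known almost everywhere, into one at every point. *)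
Lemma sobolev_regular u g1 g2 : periodic2pi u -> continuous u ->
  is_weak_derivative 1 u g1 -> is_weak_derivative 2 u g2 ->
  intg 0 (2 * pi) (fun x => g2 x ^+ 2) ->
  exists2 p, H2_triple u p g2 & eq_on_circle g1 p.
Proof.
move=> peru cu [per1 i1 w1] [per2 i2 w2] sq2.
have p2 : 0 <= 2 * pi :> R by pi_lra R.
have i1_ : intg 0 (2 * pi) g1 by [].
have i2_ : intg 0 (2 * pi) g2 by [].
have ui : intg 0 (2 * pi) u by exact: intg_continuous.
have [g20 [c1 E1]] : itg 0 (2 * pi) g2 = 0 /\ exists c, eq_on_circle g1 (fun x => c + itg 0 x g2).
  apply: weak_primitive => // phi phi' t t' D.
  have Ephi' := derive1n1E D.
  have := w1 _ (trig_test t'); have := w2 _ (trig_test t).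
  have -> : derive1n 2 phi = derive1n 1 phi' by rewrite -Ephi'.
  move=> ->; rewrite expr1 sqrrN expr1n mul1r mulN1r => E.
  by rewrite [X in - X]E opprK.
have [g10 [c0 E0]] : itg 0 (2 * pi) g1 = 0 /\ exists c, eq_on_circle u (fun x => c + itg 0 x g1).
  apply: weak_primitive => // phi phi' t t' D.
  have := w1 _ (trig_test t); rewrite (derive1n1E D) expr1 mulN1r.
  exact.
have [p perp Ep] : exists2 p, periodic2pi p &
    forall x, 0 <= x <= 2 * pi -> p x = c1 + itg 0 x g2.
  by apply: periodic_extension; rewrite g20 itg_xx.
have pp : prim 0 (2 * pi) p g2.
  split=> // x x2; rewrite !Ep// ?lexx ?p2//; first by rewrite itg_xx addr0.
have g1p : eq_on_circle g1 p.
  apply: (@filterS _ _ (ae_filter_ringOfSetsType mu) _ _ _ E1) => x H cx.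
  by rewrite H// Ep//; move: cx; rewrite circleE.
exists p => //.
split; first by split.
have pi_ := intg_cont (prim_cont p2 pp).
have Ip x : 0 <= x <= 2 * pi -> itg 0 x g1 = itg 0 x p.
  move=> /andP[x0 x2]; congr fine; apply: ae_eq_integral => //.
  - by apply/measurable_EFinP; apply: intg_measurable; exact: (intg_sub (lexx 0) x2 i1_).
  - by apply/measurable_EFinP; apply: intg_measurable; exact: (intg_sub (lexx 0) x2 pi_).
  - apply: (@filterS _ _ (ae_filter_ringOfSetsType mu) _ _ _ g1p) => y H.
    rewrite /= in_itv/= => /andP[y0 yx]; rewrite H// circleE y0/=.
    exact: le_trans x2.
have prp : prim 0 (2 * pi) (fun x => itg 0 x p) p.
  by split=> // x _; rewrite itg_xx add0r.
have uE x : 0 <= x <= 2 * pi -> u x = c0 + itg 0 x p.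
  apply: (cont_eq_on_circle (f := u) (g := fun x => c0 + itg 0 x p)).
  - exact: continuous_subspaceT.
  - by apply: (prim_cont p2 (primD (prim_cst _ _ c0) prp)).
  - apply: (@filterS _ _ (ae_filter_ringOfSetsType mu) _ _ _ E0) => y H cy.
    by rewrite H// Ip//; move: cy; rewrite circleE.
split=> //; split=> // x x2.
by rewrite !uE// ?lexx ?p2// itg_xx addr0.
Qed.

Lemma square_integrableP g : intg 0 (2 * pi) g ->
  square_integrable g <-> intg 0 (2 * pi) (fun x => g x ^+ 2).
Proof.
move=> gi; have sqE : (fun x => (g \_ (@circle R)) x ^+ 2) = (fun x => g x ^+ 2) \_ (@circle R).
  by apply/funext => x; rewrite !patchE; case: ifP; rewrite // expr0n.
have mg : measurable_fun setT (g \_ (@circle R)).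
  have mg' := intg_measurable gi.
  have mC : measurable (@circle R) by exact: measurable_itv.
  exact: ((measurable_restrictT g mC).1 mg').
have key : intg 0 (2 * pi) (fun x => g x ^+ 2) <->
    mu.-integrable setT (EFin \o (fun x => (g \_ (@circle R)) x ^+ 2)).
  by rewrite sqE /intg -restrict_EFin; exact: integrable_mkcond.
rewrite key; split; first exact: Lfun2_integrable_sqr.
move=> sqi; rewrite /square_integrable inE; apply/andP; split; first by rewrite inE.
rewrite inE /= /finite_norm unlock /=; apply: poweR_lty.
case/integrableP: sqi => _; apply: le_lt_trans.
rewrite le_eqVlt; apply/orP; left; apply/eqP.
apply: eq_integral => x _ /=.
by rewrite normrX powR_mulrn.
Qed.

End Regularity.

(** * The functional in terms of absolutely continuous representatives *)

Section Functional.
Variable R : realType.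
Local Notation mu := (@lebesgue_measure R).
Implicit Types (a b c x y : R) (f g h u p phi psi F : R -> R).

Lemma test_derive phi k x : test_function phi ->
  is_derive x 1 (derive1n k phi) (derive1n k.+1 phi x).
Proof.
move=> [_ D]; apply: DeriveDef; first exact: D.
by rewrite /derive1n iterS derive1E.
Qed.

Lemma test_cont phi k : test_function phi -> continuous (derive1n k phi).
Proof. by move=> tphi x; exact: derive_continuous (test_derive k x tphi). Qed.

Lemma derive1n_shift phi k c : test_function phi ->
  derive1n k (fun x => phi (c + x)) = (fun x => derive1n k phi (c + x)).
Proof.
move=> tphi; elim: k => // k IH.
rewrite /derive1n iterS -/(derive1n k (fun x => phi (c + x))) IH.
apply/funext => x; rewrite derive1E.
have d1 : is_derive x 1 (fun x : R => c + x) (0 + 1).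
  exact: (is_deriveD (is_derive_cst c x 1) (is_derive_id x 1)).
have := @is_derive1_comp R (derive1n k phi) (fun x => c + x) x _ _
  (test_derive k (c + x) tphi) d1.
by rewrite add0r mulr1 => D; exact: derive_val.
Qed.

Lemma test_shift phi c : test_function phi -> test_function (fun x => phi (c + x)).
Proof.
move=> tphi; split; first by move=> x; rewrite addrA tphi.1.
move=> k x; rewrite derive1n_shift//.
have d1 : is_derive x 1 (fun x : R => c + x) (0 + 1).
  exact: (is_deriveD (is_derive_cst c x 1) (is_derive_id x 1)).
have D := @is_derive1_comp R (derive1n k phi) (fun x => c + x) x _ _
  (test_derive k (c + x) tphi) d1.
by case: D.
Qed.

Lemma derive1n_periodic phi k : test_function phi -> periodic2pi (derive1n k phi).
Proof.
move=> tphi x; have := derive1n_shift k (2 * pi) tphi.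
have -> : (fun x => phi (2 * pi + x)) = phi.
  by apply/funext => y; rewrite addrC tphi.1.
by move=> /(congr1 (fun f => f x)) ->; rewrite addrC.
Qed.

Lemma derive1n_test phi k : test_function phi -> test_function (derive1n k phi).
Proof.
move=> tphi; split; first exact: derive1n_periodic.
by move=> j x; rewrite /derive1n -iterD; exact: tphi.2.
Qed.

Lemma derive1n_1_1 phi : derive1n 1 (derive1n 1 phi) = derive1n 2 phi.
Proof. by []. Qed.

Lemma derive1n_2_2 phi : derive1n 2 (derive1n 2 phi) = derive1n 4 phi.
Proof. by []. Qed.

Lemma testD_derive phi psi k : test_function phi -> test_function psi ->
  derive1n k (fun x => phi x + psi x) = (fun x => derive1n k phi x + derive1n k psi x).
Proof.
move=> tphi tpsi; elim: k => // k IH.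
rewrite /derive1n iterS -/(derive1n k (fun x => phi x + psi x)) IH.
apply/funext => x; rewrite derive1E.
have := is_deriveD (test_derive k x tphi) (test_derive k x tpsi).
by move=> D; exact: derive_val.
Qed.

Lemma testD phi psi : test_function phi -> test_function psi ->
  test_function (fun x => phi x + psi x).
Proof.
move=> tphi tpsi; split; first by move=> x; rewrite tphi.1 tpsi.1.
move=> k x; rewrite testD_derive//.
by case: (is_deriveD (test_derive k x tphi) (test_derive k x tpsi)).
Qed.

Lemma intg_mul_test f phi k : intg 0 (2 * pi) f -> test_function phi ->
  intg 0 (2 * pi) (fun x => f x * derive1n k phi x).
Proof.
move=> fi tphi; have c : {within `[0, 2 * pi], continuous (derive1n k phi)}.
  exact/continuous_subspaceT/test_cont.
by apply: eq_intg (intgM c fi) => x _; rewrite mulrC.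
Qed.

Lemma triple_intg u p g : H2_triple u p g ->
  [/\ intg 0 (2 * pi) u, intg 0 (2 * pi) p & intg 0 (2 * pi) g].
Proof.
move=> [_ [pu pp _]]; have p2 : 0 <= 2 * pi :> R by pi_lra R.
by split; [exact: intg_cont (prim_cont p2 pu)|exact: pu.1|exact: pp.1].
Qed.

Lemma triple_weak u p g : H2_triple u p g ->
  is_weak_derivative 1 u p /\ is_weak_derivative 2 u g.
Proof.
move=> upg; have [iu ip ig] := triple_intg upg.
have [[peru perp perg] [pu pp _]] := upg.
have p2 : 0 <= 2 * pi :> R by pi_lra R.
have parts F f phi : periodic2pi F -> prim 0 (2 * pi) F f -> test_function phi ->
    itg 0 (2 * pi) (fun x => F x * derive1n 1 phi x) =
    - itg 0 (2 * pi) (fun x => f x * phi x).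
  move=> perF PF tphi.
  have pphi : prim 0 (2 * pi) phi (derive1n 1 phi).
    apply: prim_derivable; last exact: test_cont.
    by move=> x; exact: (test_derive 0 x tphi).
  have := prim_itg p2 (primM p2 PF pphi).
  have -> : F (2 * pi) * phi (2 * pi) - F 0 * phi 0 = 0.
    have := perF 0; have := tphi.1 0; rewrite add0r => -> ->; exact: subrr.
  rewrite itgD; last 2 first.
  - exact: (intg_mul_test 0 PF.1 tphi).
  - apply: intg_mul_test => //; exact: intg_cont (prim_cont p2 PF).
  by move=> /eqP; rewrite addrC addr_eq0 => /eqP.
split; split=> // phi tphi.
  by rewrite expr1 mulN1r; exact: (parts _ _ _ peru pu tphi).
rewrite sqrrN expr1n mul1r.
have := parts _ _ _ peru pu (derive1n_test 1 tphi); rewrite derive1n_1_1 => E.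
by rewrite (parts _ _ _ perp pp tphi) opprK in E.
Qed.

Lemma triple_parts u p g phi : H2_triple u p g -> test_function phi ->
  itg 0 (2 * pi) (fun x => u x * derive1n 1 phi x) =
    - itg 0 (2 * pi) (fun x => p x * phi x) /\
  itg 0 (2 * pi) (fun x => u x * derive1n 2 phi x) =
    itg 0 (2 * pi) (fun x => g x * phi x).
Proof.
move=> upg tphi; have [[_ _ w1] [_ _ w2]] := triple_weak upg.
have := w1 _ tphi; have := w2 _ tphi.
by rewrite sqrrN expr1n mul1r expr1 mulN1r.
Qed.

Lemma weak_derivativeP k u g : is_weak_derivative k u g ->
  is_weak_derivative k u (weak_derivative k u).
Proof.
by move=> wg; rewrite /weak_derivative; case: xgetP => // /(_ g).
Qed.

(** The weak derivatives picked by [xget] are determined up to a null set, which the integral does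
    not see. *)
Lemma functionalE u p g : H2_triple u p g ->
  functional u = energy u p g * itg 0 (2 * pi) (fun x => u x `^ (- (2 / 3))) ^+ 3.
Proof.
move=> upg; have [w1 w2] := triple_weak upg.
have := weak_derivativeP w1; have := weak_derivativeP w2.
rewrite /functional; move: (weak_derivative 1 u) (weak_derivative 2 u) => g1 g2 W2 W1.
congr (_ * _).
have e1 := weak_unique W1 w1; have e2 := weak_unique W2 w2.
have mu_ (f : R -> R) : intg 0 (2 * pi) f -> measurable_fun (@circle R) f.
  exact: intg_measurable.
have m1 := mu_ _ (let: And3 _ i _ := W1 in i).
have m2 := mu_ _ (let: And3 _ i _ := W2 in i).
have [iu _ _] := triple_intg upg.
have m0 := mu_ _ iu.
apply: (@eq_on_circle_itg _ (fun x => g2 x ^+ 2 - 10 * g1 x ^+ 2 + 9 * u x ^+ 2)).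
- apply: measurable_funD; first apply: measurable_funB.
  + exact: measurable_funX.
  + by apply: measurable_funM => //; exact: measurable_funX.
  + by apply: measurable_funM => //; exact: measurable_funX.
- exact: mu_ (eform_intg upg).
- apply: (@filterS2 _ _ (ae_filter_ringOfSetsType mu) _ _ _ _ e1 e2) => x H1 H2 cx.
  by rewrite /eform H1// H2.
Qed.

Lemma triple_sobolev u p g : H2_triple u p g -> continuous u -> sobolevH2 u.
Proof.
move=> upg cu; have [w1 w2] := triple_weak upg.
have [[peru perp perg] [pu pp sq]] := upg.
have p2 : 0 <= 2 * pi :> R by pi_lra R.
split=> // -[//|[_|[_|//]]].
  exists p => //; apply/square_integrableP; first exact: pu.1.
  exact: intgM (prim_cont p2 pp) (intg_cont (prim_cont p2 pp)).
by exists g => //; apply/square_integrableP => //; exact: pp.1.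
Qed.

Lemma sobolev_triple u : sobolevH2 u -> exists p g, H2_triple u p g.
Proof.
move=> [peru cu H].
have [g1 w1 _] := H 1%N isT; have [g2 w2 sq2] := H 2 isT.
have [_ i2 _] := w2.
have [p upg _] := sobolev_regular peru cu w1 w2 (proj1 (square_integrableP i2) sq2).
by exists p, g2.
Qed.

Lemma functional_lower_bound u : admissible u -> 36^-1 <= functional u.
Proof.
move=> [sob u0 _]; have [p [g upg]] := sobolev_triple sob.
rewrite (functionalE upg); apply: energy_lower_bound => //.
by case: sob.
Qed.

End Functional.

(** * Convexity, first variation, and averaging over the half turn *)

Section Variation.
Variable R : realType.
Local Notation mu := (@lebesgue_measure R).
Implicit Types (a b c x y t : R) (f g h u p v phi psi F : R -> R).

Lemma pi_range : 0 <= (pi : R) <= 2 * pi.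
Proof. by pi_lra R. Qed.

(** Strict convexity at the midpoint by two uses of the arithmetic-geometric inequality: with
    capitals for powers - 1 / 3, [m ^ 2 >= x y] gives [M ^ 2 <= X Y], and [2 X Y <= X ^ 2 + Y ^ 2].
    Equality in the second forces [X = Y]. *)
Lemma midpoint_powR x y : 0 < x -> 0 < y ->
  2 * ((x + y) / 2) `^ (- (2 / 3)) <= x `^ (- (2 / 3)) + y `^ (- (2 / 3)) /\
  (2 * ((x + y) / 2) `^ (- (2 / 3)) = x `^ (- (2 / 3)) + y `^ (- (2 / 3)) -> x = y).
Proof.
move=> x0 y0; have : 0 < (x + y) / 2 by rewrite divr_gt0// addr_gt0.
move mE : ((x + y) / 2) => m m0.
have sq (z : R) : 0 < z -> z `^ (- (2 / 3)) = (z `^ (- 3^-1)) ^+ 2.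
  by move=> z0; rewrite -powR_mulrn ?powR_ge0// -powRrM; congr (_ `^ _); field.
rewrite !sq//; set X := x `^ _; set Y := y `^ _; set M := m `^ _.
have X0 : 0 < X by exact: powR_gt0.
have Y0 : 0 < Y by exact: powR_gt0.
have XY : M ^+ 2 <= X * Y.
  have [m1 x1 y1] : [/\ 0 <= m, 0 <= x & 0 <= y] by split; exact: ltW.
  rewrite /M -powR_mulrn ?powR_ge0// powRAC powR_mulrn// /X /Y -powRM//.
  rewrite !powRN lef_pV2 ?posrE ?powR_gt0 ?mulr_gt0 ?exprn_gt0//.
  apply: ge0_ler_powR; rewrite ?nnegrE ?invr_ge0 ?mulr_ge0 ?exprn_ge0//.
  rewrite -subr_ge0 -mE (_ : _ - _ = ((x - y) / 2) ^+ 2); last by field.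
  exact: sqr_ge0.
have amgm : X ^+ 2 + Y ^+ 2 = 2 * (X * Y) + (X - Y) ^+ 2 by ring.
have d0 := sqr_ge0 (X - Y).
split; first by rewrite amgm; lra.
rewrite amgm => E.
have /eqP : (X - Y) ^+ 2 = 0 by lra.
rewrite sqrf_eq0 subr_eq0 => /eqP XYe.
have inv (z : R) : 0 < z -> (z `^ (- 3^-1)) `^ (- 3) = z.
  by move=> z0; rewrite -powRrM mulrNN mulVf// powRr1//; exact: ltW.
by rewrite -(inv x)// -/X XYe inv.
Qed.

(** Cubing turns the claim into [(1 + y) ^ 3 (1 + t) ^ 2 >= 1], where [(1 + y) ^ 3 >= 1 + 3 y]
    suffices. The coefficient 2, larger than the Taylor coefficient 5 / 9, pays for that loss; the
    range 1 / 4 keeps [3 + 10 t + 6 t ^ 2] positive. *)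
Lemma powR_taylor t : `|t| <= 4^-1 ->
  (1 + t) `^ (- (2 / 3)) <= 1 - 2 / 3 * t + 2 * t ^+ 2.
Proof.
rewrite ler_norml => /andP[tl tr].
have t1 : 0 < 1 + t by lra.
pose y := - (2 / 3) * t + 2 * t ^+ 2.
have -> : 1 - 2 / 3 * t + 2 * t ^+ 2 = 1 + y by rewrite /y; ring.
have y1 : - 18^-1 <= y.
  rewrite -subr_ge0 (_ : _ - _ = 2 * (t - 6^-1) ^+ 2); last by rewrite /y; field.
  by rewrite mulr_ge0// sqr_ge0.
have Z0 : 0 <= 1 + y by lra.
rewrite -(@ler_pXn2r _ 3) ?nnegrE ?powR_ge0//.
rewrite -powR_mulrn ?powR_ge0// -powRrM mulNr mulfVK// powR_invn; last exact: ltW.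
rewrite -[leLHS]mul1r ler_pdivrMr ?exprn_gt0//.
have cube : 1 + 3 * y <= (1 + y) ^+ 3.
  rewrite -subr_ge0 (_ : _ - _ = y ^+ 2 * (3 + y)); last by ring.
  by rewrite mulr_ge0 ?sqr_ge0//; lra.
have sq0 : 0 <= (1 + t) ^+ 2 by exact: sqr_ge0.
apply: (@le_trans _ _ ((1 + 3 * y) * (1 + t) ^+ 2)); last by rewrite ler_wpM2r.
rewrite -subr_ge0 (_ : _ - _ = t ^+ 2 * (3 + 10 * t + 6 * t ^+ 2)); last by rewrite /y; field.
rewrite mulr_ge0 ?sqr_ge0//; have := sqr_ge0 t; lra.
Qed.

(** A polynomial in [t] that dominates its value at 0 on both sides of 0 has no linear term; here
    that term is [2 (B I ^ 3 - E I ^ 2 D)]. A polynomial upper bound replaces differentiation of the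
    functional. *)
Lemma first_variation_eq0 (E B F I D C d : R) : 0 < d ->
  (forall t, `|t| <= d -> E * I ^+ 3 <=
     (E + 2 * t * B + t ^+ 2 * F) * (I - 2 / 3 * t * D + C * t ^+ 2) ^+ 3) ->
  B * I ^+ 3 = E * I ^+ 2 * D.
Proof.
move=> d0 H; pose L := 2 * (B * I ^+ 3 - E * I ^+ 2 * D).
pose b : R := - (2 / 3) * D.
pose Y t := b + C * t.
pose W t := 3 * I * I * C + 3 * I * (Y t * Y t) + t * (Y t * (Y t * Y t)).
pose Q t := E * W t + F * (I * (I * I)) + (2 * B + t * F) * (3 * I * I * b + t * W t).
have expand t : (E + 2 * t * B + t ^+ 2 * F) * (I - 2 / 3 * t * D + C * t ^+ 2) ^+ 3
    = E * I ^+ 3 + t * (L + t * Q t).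
  by rewrite /Q /W /Y /L /b; field.
have cid : cont0 (fun t : R => t) by exact: cvg_id.
have cQ s : cont0 (fun t => s * L + t * Q (s * t)).
  by rewrite /Q /W /Y; solve_cont0.
(* [s] is 1 or - 1, the sign of the increment: the inequality at [s t] is divided by [t > 0], then
   [t] tends to 0. *)
have pos s : s ^+ 2 = 1 -> 0 <= s * L.
  move=> s2; have := @ge0_at0 _ (fun t => s * L + t * Q (s * t)) d d0 (cQ s).
  rewrite mul0r addr0; apply=> t /andP[t0 td].
  have := H (s * t); rewrite expand normrM.
  have -> : `|s| = 1 by apply/eqP; rewrite -sqr_norm_eq1 s2.
  rewrite mul1r gtr0_norm// ltW// => /(_ isT).
  rewrite lerDl (_ : s * t * (L + s * t * Q (s * t)) = t * (s * L + s ^+ 2 * (t * Q (s * t)))); last by ring.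
  by rewrite s2 mul1r pmulr_rge0.
have L1 := pos 1 (expr1n _ _).
have L2 : 0 <= -1 * L by apply: pos; rewrite sqrrN expr1n.
have : L = 0 by lra.
by rewrite /L; lra.
Qed.

Lemma triple_lin a b u p g v q h : H2_triple u p g -> H2_triple v q h ->
  H2_triple (fun x => a * u x + b * v x) (fun x => a * p x + b * q x)
    (fun x => a * g x + b * h x).
Proof.
move=> [[peru perp perg] [pu pp sg]] [[perv perq perh] [pv pq sh]].
split; first by split=> x; rewrite ?peru ?perp ?perg ?perv ?perq ?perh.
split; [exact: primD (primZ a pu) (primZ b pv)|exact: primD (primZ a pp) (primZ b pq)|].
have mg := intg_measurable pp.1; have mh := intg_measurable pq.1.
have dom := intgD (intgZ (2 * a ^+ 2) sg) (intgZ (2 * b ^+ 2) sh).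
apply: (@le_integrable _ _ _ mu _ (measurable_itv _) _ _ _ _ dom).
  apply/measurable_EFinP; apply: measurable_funX; apply: measurable_funD;
  exact: measurable_funM.
move=> x _; rewrite /= lee_fin ger0_norm ?sqr_ge0// ger0_norm; last first.
  by rewrite addr_ge0// mulr_ge0 ?sqr_ge0// mulr_ge0 ?sqr_ge0.
rewrite -subr_ge0 (_ : _ - _ = (a * g x - b * h x) ^+ 2); last by ring.
exact: sqr_ge0.
Qed.

(** The half turn preserves [v] and changes the sign of the cubed cosine, so the integral equals its
    opposite. *)
Lemma cos3_orthogonal_piperiodic v : continuous v -> (forall x, 0 < v x) ->
  (forall x, v (pi + x) = v x) -> periodic2pi v -> cos3_orthogonal v.
Proof.
move=> cv v0 vpi perv alpha.
pose h x := cos (x + alpha) ^+ 3 / (v x `^ (5 / 3)).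
have ch : continuous h.
  move=> x; apply: cvgM.
    rewrite (_ : (fun x => cos (x + alpha) ^+ 3) = (fun x => cos (x + alpha) *
      (cos (x + alpha) * cos (x + alpha)))); last first.
      by apply/funext => y; rewrite !exprS expr0 mulr1.
    have cc : {for x, continuous (fun y => cos (y + alpha))}.
      apply: continuous_comp; last exact: continuous_cos.
      by apply: cvgD; [exact: cvg_id|exact: cvg_cst].
    by apply: cvgM; [exact: cc|apply: cvgM; exact: cc].
  apply: cvgV; last exact: cont_powR.
  by rewrite gt_eqF// powR_gt0.
have hpi x : h (pi + x) = - h x.
  by rewrite /h vpi -addrA (addrC pi) cosDpi; ring.
have perh : periodic2pi h.
  move=> x; rewrite (_ : x + 2 * pi = pi + (pi + x)); last by ring.
  by rewrite !hpi opprK.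
have hi : intg 0 (2 * pi) h by exact: intg_continuous.
have := itg_periodic perh hi pi_range.
rewrite (@eq_itg _ _ _ _ (fun x => - h x)); last by move=> x _; exact: hpi.
by rewrite itgN// -/(itg _ _ h) => E; rewrite -[LHS]/(itg 0 (2 * pi) h); lra.
Qed.

Section Symmetrization.
Variables u p g : R -> R.
Hypothesis upg : H2_triple u p g.
Hypothesis cu : continuous u.
Hypothesis u0 : forall x, 0 < u x.

Definition even_part f x : R := 2^-1 * f x + 2^-1 * f (pi + x).
Definition odd_part f x : R := 2^-1 * f x + (- 2^-1) * f (pi + x).

Lemma even_triple : H2_triple (even_part u) (even_part p) (even_part g).
Proof. exact: triple_lin (shift_triple upg pi_range). Qed.

Lemma odd_triple : H2_triple (odd_part u) (odd_part p) (odd_part g).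
Proof. exact: triple_lin (shift_triple upg pi_range). Qed.

Lemma cont_shift f c : continuous f -> continuous (fun x => f (c + x)).
Proof.
move=> cf x; apply: continuous_comp; last exact: cf.
by apply: cvgD; [exact: cvg_cst|exact: cvg_id].
Qed.

Lemma even_cont : continuous (even_part u).
Proof.
move=> x; apply: cvgD; (apply: cvgM; first exact: cvg_cst); first exact: cu.
exact: cont_shift.
Qed.

Lemma even_gt0 x : 0 < even_part u x.
Proof. by rewrite addr_gt0// mulr_gt0// invr_gt0. Qed.

Lemma even_pi x : even_part u (pi + x) = even_part u x.
Proof.
have [[peru _ _] _] := upg; rewrite /even_part addrC; congr (_ * _ + _).
by rewrite -[RHS]peru; congr u; ring.
Qed.

Lemma even_admissible : admissible (even_part u).
Proof.
split; [exact: triple_sobolev even_triple even_cont|exact: even_gt0|].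
apply: cos3_orthogonal_piperiodic; [exact: even_cont|exact: even_gt0|exact: even_pi|].
by case: even_triple => -[].
Qed.

(** The parallelogram identity for the quadratic energy, whose value is unchanged by the half
    turn. *)
Lemma energy_even_odd : energy u p g =
  energy (even_part u) (even_part p) (even_part g) +
  energy (odd_part u) (odd_part p) (odd_part g).
Proof.
have i0 := eform_intg upg.
have i1 := eform_intg (shift_triple upg pi_range).
have e1 := energy_shift upg pi_range.
have ie := eform_intg even_triple; have io := eform_intg odd_triple.
rewrite /energy -itgD// [RHS](@eq_itg _ _ _ _ (fun x => 2^-1 * eform u p g x +
  2^-1 * eform (fun x => u (pi + x)) (fun x => p (pi + x)) (fun x => g (pi + x)) x)); last first.
  by move=> x _; rewrite /eform /even_part /odd_part; field.
rewrite [RHS]itgD; [|exact: intgZ|exact: intgZ].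
rewrite (itgZ _ i0) (itgZ _ i1).
by rewrite -!/(energy _ _ _) e1 /energy; field.
Qed.

(** The values of the odd part at opposite points sum to zero, and so do its slopes. The lower bound
    for the energy thus applies at 0, and its right-hand side is zero. *)
Lemma energy_odd_ge0 : 0 <= energy (odd_part u) (odd_part p) (odd_part g).
Proof.
have [[peru perp _] _] := upg.
have z2 : 0 <= (0 : R) <= 2 * pi by pi_lra R.
have odd0 f : periodic2pi f -> odd_part f 0 + odd_part f (0 + pi) = 0.
  move=> perf; rewrite /odd_part addr0 add0r.
  have -> : f (pi + pi) = f 0.
    have -> : pi + pi = 0 + 2 * pi :> R by ring.
    exact: perf.
  by ring.
have := energy_ge odd_triple z2 (odd0 _ perp).
by rewrite odd0// mulr0 mul0r.
Qed.

(** The midpoint defect [k] is continuous and nonnegative, and its integral is the gap between the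
    two sides; a zero gap forces the equality case of convexity at every point. *)
Lemma even_powR_integral :
  let I f := itg 0 (2 * pi) (fun x => f x `^ (- (2 / 3))) in
  I (even_part u) <= I u /\
  (I (even_part u) = I u -> forall x, 0 <= x <= 2 * pi -> u (pi + x) = u x).
Proof.
move=> I; pose r : R := - (2 / 3).
have [[peru _ _] _] := upg.
have cr : continuous (fun x => u x `^ r) by exact: cont_powR.
have ce : continuous (fun x => even_part u x `^ r).
  by apply: cont_powR; [exact: even_cont|exact: even_gt0].
pose k x := 2^-1 * (u x `^ r) + 2^-1 * (u (pi + x) `^ r) - even_part u x `^ r.
have cs : continuous (fun x => u (pi + x) `^ r) by exact: (@cont_shift _ pi cr).
have ck : continuous k.
  move=> x; apply: cvgB; last exact: ce.
  by apply: cvgD; (apply: cvgM; first exact: cvg_cst); [exact: cr|exact: cs].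
have mid x := midpoint_powR (u0 x) (u0 (pi + x)).
have evE x : even_part u x = (u x + u (pi + x)) / 2 by rewrite /even_part; field.
have k0 x : 0 <= k x by rewrite /k evE; have [+ _] := mid x; rewrite -/r; lra.
have ir := @intg_continuous _ 0 (2 * pi) _ cr.
have is_ := @intg_continuous _ 0 (2 * pi) _ cs.
have ie := @intg_continuous _ 0 (2 * pi) _ ce.
have perr : periodic2pi (fun x => u x `^ r) by move=> x; rewrite peru.
have sh := itg_periodic perr ir pi_range.
have Ik : itg 0 (2 * pi) k = I u - I (even_part u).
  rewrite itgB//; last by apply: intgD; exact: intgZ.
  rewrite itgD; [|exact: intgZ|exact: intgZ].
  rewrite !itgZ// sh.
  by rewrite /I -/r; field.
split; first by rewrite -subr_ge0 -Ik; apply: itg_ge0.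
move=> E x x2; have p2 : 0 < 2 * pi :> R by pi_lra R.
have /(_ _ x2) kx : forall x, 0 <= x <= 2 * pi -> k x = 0.
  apply: cont_itg0 => //; first exact: continuous_subspaceT.
  by rewrite Ik E subrr.
have [_ ->//] := mid x.
by move: kx; rewrite /k evE -/r; lra.
Qed.

End Symmetrization.

End Variation.

(** * The weak Euler-Lagrange equation of a [pi]-periodic minimizer *)

Section EulerLagrange.
Variable R : realType.
Local Notation mu := (@lebesgue_measure R).
Implicit Types (a b c x y t : R) (f g h u p v phi psi F : R -> R).

Lemma periodic_rep x : exists2 y, 0 <= y <= 2 * pi & forall f, periodic2pi f -> f x = f y.
Proof.
have p2 : 0 < 2 * pi :> R by pi_lra R.
pose n := Num.floor (x / (2 * pi)).
have /andP[n1 n2] : n%:~R <= x / (2 * pi) < (n + 1)%:~R by exact: floor_itv.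
exists (x - n%:~R * (2 * pi)).
  rewrite subr_ge0 -ler_pdivlMr// n1/= lerBlDr.
  by rewrite -[leRHS]/(2 * pi + _) -{1}[2 * pi]mul1r -mulrDl -ler_pdivrMr// addrC -(intrD _ n 1) ltW.
move=> f perf.
have nat_shift (m : nat) z : f (z + m%:R * (2 * pi)) = f z.
  by rewrite mulr_natl periodicn.
case: n {n1 n2} => m.
  by rewrite -[RHS](nat_shift m) /= subrK.
by rewrite NegzE mulrNz mulNr opprK -pmulrn nat_shift.
Qed.

Lemma test_triple psi : test_function psi ->
  H2_triple psi (derive1n 1 psi) (derive1n 2 psi).
Proof.
move=> tpsi; split.
  split; [exact: tpsi.1|exact: derive1n_periodic|exact: derive1n_periodic].
have c1 := @test_cont _ psi 1 tpsi; have c2 := @test_cont _ psi 2 tpsi.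
split.
- exact: (@prim_derivable _ _ _ psi _ (fun x => @test_derive _ psi 0 x tpsi) c1).
- exact: (@prim_derivable _ _ _ (derive1n 1 psi) _ (fun x => @test_derive _ psi 1 x tpsi) c2).
- apply: intgM; first exact: continuous_subspaceT.
  exact: intg_continuous.
Qed.

(** The linear operator in the symmetric Q-curvature, here applied to test functions; it is formally
    self-adjoint, which gives the weak form. *)
Definition paneitz phi x :=
  derive1n 4 phi x + 10 * derive1n 2 phi x + 9 * phi x.

Lemma paneitz_intg f phi : test_function phi -> continuous f ->
  intg 0 (2 * pi) (fun x => f x * paneitz phi x) /\
  itg 0 (2 * pi) (fun x => f x * paneitz phi x) =
    itg 0 (2 * pi) (fun x => f x * derive1n 4 phi x)
    + 10 * itg 0 (2 * pi) (fun x => f x * derive1n 2 phi x)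
    + 9 * itg 0 (2 * pi) (fun x => f x * phi x).
Proof.
move=> tphi cf; have fi : intg 0 (2 * pi) f by exact: intg_continuous.
have i4 := intg_mul_test 4 fi tphi; have i2 := intg_mul_test 2 fi tphi.
have i0 : intg 0 (2 * pi) (fun x => f x * phi x) by exact: (intg_mul_test 0 fi tphi).
rewrite /paneitz; move: (derive1n 4 phi) (derive1n 2 phi) i4 i2 => phi4 phi2 i4 i2.
have i := intgD (intgD i4 (intgZ 10 i2)) (intgZ 9 i0).
split; first by apply: eq_intg i => x _; ring.
rewrite -(itgZ 10 i2) -(itgZ 9 i0) -itgD//; last exact: intgZ.
rewrite -itgD; [|by apply: intgD => //; exact: intgZ|exact: intgZ].
by apply: eq_itg => x _; ring.
Qed.

Section Minimizer.
Variables v p g : R -> R.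
Hypothesis vpg : H2_triple v p g.
Hypothesis cv : continuous v.
Hypothesis v0 : forall x, 0 < v x.
Hypothesis vpi : forall x, v (pi + x) = v x.
Hypothesis vmin : forall f, admissible f -> functional v <= functional f.

Let I f := itg 0 (2 * pi) (fun x => f x `^ (- (2 / 3))).
Let E := energy v p g.
(** The power [v ^ (- 5 / 3)], in the form that arises from expanding
    [(v (1 + t psi / v)) ^ (- 2 / 3)]. *)
Let s x := v x `^ (- (2 / 3)) / v x.

Let cs : continuous s.
Proof.
move=> x; apply: cvgM; first exact: cont_powR.
by apply: cvgV; [rewrite gt_eqF|exact: cv].
Qed.

Section Direction.
Variable psi : R -> R.
Hypothesis tpsi : test_function psi.
Hypothesis psipi : forall x, psi (pi + x) = psi x.

(** Along [v + t psi] the energy equals [E + 2 t B + t ^ 2 F], and the integral of the power - 2 / 3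
    is at most [I v - 2 / 3 t D + C t ^ 2] for small [t]. *)
Let vt t x := 1 * v x + t * psi x.
Let B := itg 0 (2 * pi) (fun x => v x * paneitz psi x).
Let F := energy psi (derive1n 1 psi) (derive1n 2 psi).
Let D := itg 0 (2 * pi) (fun x => s x * psi x).
Let rho x := psi x / v x.
Let C := itg 0 (2 * pi) (fun x => 2 * (v x `^ (- (2 / 3)) * (rho x * rho x))).

Let vt_triple t : H2_triple (vt t) (fun x => 1 * p x + t * derive1n 1 psi x)
  (fun x => 1 * g x + t * derive1n 2 psi x).
Proof. exact: triple_lin vpg (test_triple tpsi). Qed.

Let vt_cont t : continuous (vt t).
Proof.
move=> x; apply: cvgD; apply: cvgM; try exact: cvg_cst; first exact: cv.
exact: (@test_cont _ psi 0 tpsi).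
Qed.

Let energy_vt t : energy (vt t) (fun x => 1 * p x + t * derive1n 1 psi x)
  (fun x => 1 * g x + t * derive1n 2 psi x) = E + 2 * t * B + t ^+ 2 * F.
Proof.
have iE := eform_intg vpg; have iF := eform_intg (test_triple tpsi).
have [iv ip ig] := triple_intg vpg.
have i2 := intg_mul_test 2 ig tpsi; have i1 := intg_mul_test 1 ip tpsi.
have i0 : intg 0 (2 * pi) (fun x => v x * psi x) by exact: (intg_mul_test 0 iv tpsi).
have [_ W2] := triple_parts vpg (derive1n_test 2 tpsi).
have [W1 _] := triple_parts vpg (derive1n_test 1 tpsi).
rewrite derive1n_2_2 in W2.
rewrite derive1n_1_1 in W1.
have := (paneitz_intg tpsi cv).2; rewrite -[LHS]/B.
move: iF i1 i2 W1 W2; rewrite /F.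
move: (derive1n 4 psi) (derive1n 1 psi) (derive1n 2 psi) => psi4 psi1 psi2.
move=> iF i1 i2 W1 W2; rewrite W2 W1 => ->.
have iB : intg 0 (2 * pi) (fun x => g x * psi2 x
    - 10 * (p x * psi1 x) + 9 * (v x * psi x)).
  by apply: intgD; [apply: intgB => //|]; exact: intgZ.
have -> : itg 0 (2 * pi) (fun x => g x * psi2 x) +
    10 * - itg 0 (2 * pi) (fun x => p x * psi1 x) +
    9 * itg 0 (2 * pi) (fun x => v x * psi x) =
    itg 0 (2 * pi) (fun x => g x * psi2 x - 10 * (p x * psi1 x) + 9 * (v x * psi x)).
  rewrite mulrN -(itgZ 10 i1) -(itgZ 9 i0) -itgB//; last exact: intgZ.
  by rewrite -itgD//; [apply: intgB => //|]; exact: intgZ.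
rewrite /E /energy -(itgZ (2 * t) iB) -(itgZ (t ^+ 2) iF).
rewrite -[in RHS]itgD//; last exact: intgZ.
rewrite -[in RHS]itgD; [|by apply: intgD => //; exact: intgZ|exact: intgZ].
by apply: eq_itg => x _; rewrite /eform /vt; ring.
Qed.

Let rho_cont : continuous rho.
Proof.
move=> x; apply: cvgM; first exact: (@test_cont _ psi 0 tpsi).
by apply: cvgV; [rewrite gt_eqF|exact: cv].
Qed.

(** Periodicity reduces the bound on [rho] to a compact segment; 1 / 4 is the range of the quadratic
    estimate for the power and also keeps [v + t psi] positive. *)
Let rho_bound : exists2 d, 0 < d & forall t x, `|t| <= d -> `|t * rho x| <= 4^-1.
Proof.
have [[perv _ _] _] := vpg.
have p2 : 0 <= 2 * pi :> R by pi_lra R.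
have cn : {within `[0, 2 * pi], continuous (fun x => `|rho x|)}.
  by apply: continuous_subspaceT => x; apply: cvg_norm; exact: rho_cont.
have [c _ cmax] := EVT_max p2 cn.
have bound x : `|rho x| <= `|rho c|.
  have [y y2 H] := periodic_rep x; rewrite (H rho); last first.
    by move=> z; rewrite /rho perv tpsi.1.
  by apply: cmax; rewrite in_itv.
exists (4^-1 / (`|rho c| + 1)).
  by rewrite divr_gt0// ltr_wpDl.
move=> t x td; rewrite normrM.
apply: (@le_trans _ _ (4^-1 / (`|rho c| + 1) * (`|rho c| + 1))).
  by rewrite ler_pM// (le_trans (bound x))// lerDl.
by rewrite mulfVK// gt_eqF// ltr_wpDl.
Qed.

Let vtE t x : vt t x = v x * (1 + t * rho x).
Proof. by rewrite /vt /rho; field; rewrite gt_eqF. Qed.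

Lemma euler_lagrange_even : B * I v = E * D.
Proof.
have [d d0 dP] := rho_bound.
have ti_pos t x : `|t| <= d -> 0 < 1 + t * rho x.
  by move=> td; have := dP t x td; rewrite ler_norml; lra.
have vt0 t x : `|t| <= d -> 0 < vt t x.
  by move=> td; rewrite vtE mulr_gt0// ti_pos.
have [[perv _ _] _] := vpg.
have cr : continuous (fun x => v x `^ (- (2 / 3))) by exact: cont_powR.
have ir := @intg_continuous _ 0 (2 * pi) _ cr.
have isp : intg 0 (2 * pi) (fun x => s x * psi x).
  by apply: (intg_mul_test 0 _ tpsi); exact: intg_continuous.
have irr : intg 0 (2 * pi) (fun x => 2 * (v x `^ (- (2 / 3)) * (rho x * rho x))).
  apply: intgZ; apply: intg_continuous => x; apply: cvgM; first exact: cr.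
  by apply: cvgM; exact: rho_cont.
have It t : `|t| <= d -> I (vt t) <= I v - 2 / 3 * t * D + C * t ^+ 2.
  move=> td; have ivt : intg 0 (2 * pi) (fun x => vt t x `^ (- (2 / 3))).
    by apply: intg_continuous; apply: cont_powR => // x; exact: vt0.
  rewrite /I /D /C (mulrC _ (t ^+ 2)) -(itgZ (2 / 3 * t) isp) -(itgZ (t ^+ 2) irr).
  rewrite -itgB//; last exact: intgZ.
  rewrite -itgD; [|by apply: intgB => //; exact: intgZ|exact: intgZ].
  apply: le_itg => //.
    by apply: intgD; [apply: intgB => //|]; exact: intgZ.
  move=> x _; rewrite vtE powRM ?(ltW (v0 x)) ?(ltW (ti_pos t x td))//.
  have := powR_taylor (dP t x td).
  have P0 : 0 <= v x `^ (- (2 / 3)) by exact: powR_ge0.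
  move=> /(ler_wpM2l P0) /le_trans; apply.
  rewrite le_eqVlt; apply/orP; left; apply/eqP.
  by rewrite /s /rho; field; rewrite gt_eqF.
have Iv0 : 0 < I v.
  have p2 : 0 < 2 * pi :> R by pi_lra R.
  have I0 : 0 <= I v by apply: itg_ge0 => x _; exact: powR_ge0.
  rewrite lt_neqAle I0 andbT eq_sym; apply/eqP => Iv0.
  have := cont_itg0 p2 (continuous_subspaceT cr) (fun x _ => powR_ge0 _ _) Iv0.
  move=> /(_ 0); rewrite lexx (ltW p2) => /(_ isT) /eqP.
  by rewrite gt_eqF// powR_gt0.
have := @first_variation_eq0 R E B F (I v) D C d d0 _.
suff H t : `|t| <= d -> E * I v ^+ 3 <=
     (E + 2 * t * B + t ^+ 2 * F) * (I v - 2 / 3 * t * D + C * t ^+ 2) ^+ 3.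
  move=> /(_ H) EL; apply: (@mulfI _ (I v ^+ 2)); first by rewrite expf_neq0// gt_eqF.
  by rewrite mulrCA -exprSr EL; ring.
move=> td; have vtp x := vt0 t x td.
have adm : admissible (vt t).
  split; [exact: triple_sobolev (vt_triple t) (@vt_cont t)|by []|].
  apply: cos3_orthogonal_piperiodic => //; first by move=> x; rewrite /vt vpi psipi.
  by case: (vt_triple t) => -[].
have := vmin adm; rewrite (functionalE vpg) (functionalE (vt_triple t)).
have low := energy_lower_bound (vt_triple t) (@vt_cont t) vtp.
rewrite energy_vt -/(I _) -/(I _) -/E in low *; rewrite -/(I v).
have I0 : 0 <= I (vt t) by apply: itg_ge0 => x _; exact: powR_ge0.
have I3 : 0 <= I (vt t) ^+ 3 by exact: exprn_ge0.
(* The energy must be nonnegative before the upper bound on the integral is multiplied by it. The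
   lower bound for [vt t] gives this: its product with a nonnegative cube is at least 1 / 36. *)
have E0 : 0 <= E + 2 * t * B + t ^+ 2 * F.
  rewrite leNgt; apply/negP => En.
  have : (E + 2 * t * B + t ^+ 2 * F) * I (vt t) ^+ 3 <= 0 by rewrite nmulr_rle0.
  have : 0 < 36^-1 :> R by rewrite invr_gt0.
  lra.
move=> /le_trans; apply; rewrite ler_wpM2l// lerXn2r ?nnegrE ?It//.
exact: le_trans I0 (It t td).
Qed.

End Direction.

(** [v] and [s] have period [pi], so testing against [phi (x) + phi (pi + x)], an allowed direction,
    doubles every integral against [phi]. *)
Lemma euler_lagrange phi : test_function phi ->
  itg 0 (2 * pi) (fun x => v x * paneitz phi x) * I v =
  E * itg 0 (2 * pi) (fun x => s x * phi x).
Proof.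
move=> tphi; have [[perv _ _] _] := vpg.
pose psi x := phi x + phi (pi + x).
have tphi' := test_shift pi tphi.
have tpsi : test_function psi by exact: testD.
have psipi x : psi (pi + x) = psi x.
  rewrite /psi addrC; congr (_ + _); rewrite -[RHS]tphi.1; congr phi; ring.
have := euler_lagrange_even tpsi psipi.
have twice h k : continuous h -> (forall x, h (pi + x) = h x) -> periodic2pi h ->
    test_function k ->
    itg 0 (2 * pi) (fun x => h x * k (pi + x)) = itg 0 (2 * pi) (fun x => h x * k x).
  move=> ch hpi perh tk.
  have ik : intg 0 (2 * pi) (fun x => h x * k x).
    by apply: (intg_mul_test 0 _ tk); exact: intg_continuous.
  have per : periodic2pi (fun x => h x * k x) by move=> x; rewrite perh tk.1.
  rewrite -(itg_periodic per ik (pi_range R)).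
  by apply: eq_itg => x _; rewrite hpi.
have spi x : s (pi + x) = s x by rewrite /s vpi.
have pers : periodic2pi s by move=> x; rewrite /s perv.
have tw k : itg 0 (2 * pi) (fun x => v x * derive1n k psi x) =
    2 * itg 0 (2 * pi) (fun x => v x * derive1n k phi x).
  have iv : intg 0 (2 * pi) v by exact: intg_continuous.
  have tk := derive1n_test k tphi; have tk' := derive1n_test k tphi'.
  have dE : derive1n k psi = (fun x => derive1n k phi x + derive1n k phi (pi + x)).
    by rewrite (testD_derive k tphi tphi') derive1n_shift.
  rewrite dE (@eq_itg _ _ _ _ (fun x => v x * derive1n k phi x + v x * derive1n k phi (pi + x))); last first.
    by move=> x _; rewrite mulrDr.
  rewrite itgD ?twice//; first by ring.
    exact: (intg_mul_test k iv tphi).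
  have := intg_mul_test k iv tphi'.
  by rewrite derive1n_shift.
have tws : itg 0 (2 * pi) (fun x => s x * psi x) = 2 * itg 0 (2 * pi) (fun x => s x * phi x).
  have is_ : intg 0 (2 * pi) s by exact: intg_continuous.
  rewrite (@eq_itg _ _ _ _ (fun x => s x * phi x + s x * phi (pi + x))); last first.
    by move=> x _; rewrite /psi mulrDr.
  rewrite itgD ?twice//; first by ring.
    exact: (intg_mul_test 0 is_ tphi).
  exact: (intg_mul_test 0 is_ tphi').
have t0 : itg 0 (2 * pi) (fun x => v x * psi x) = 2 * itg 0 (2 * pi) (fun x => v x * phi x).
  exact: (tw 0%N).
have P1 := (paneitz_intg tpsi cv).2; have P2 := (paneitz_intg tphi cv).2.
rewrite tws P1 P2; move: (tw 4) (tw 2) => {P1 P2}.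
move: (derive1n 4 psi) (derive1n 4 phi) (derive1n 2 psi) (derive1n 2 phi) => f4 f4' f2 f2'.
move=> -> ->; rewrite t0 => H.
by apply: (@mulfI _ 2) => //; rewrite [RHS]mulrCA -H; ring.
Qed.

End Minimizer.
End EulerLagrange.


(** * Extremals have constant symmetric Q-curvature *)

Lemma extremal_squeeze (R : realType) (Eu Ev Iu Iv : R) : 0 <= Iv ->
  36^-1 <= Ev * Iv ^+ 3 -> Ev <= Eu -> Iv <= Iu -> Eu * Iu ^+ 3 <= Ev * Iv ^+ 3 ->
  0 < Iv /\ Iv = Iu.
Proof.
move=> Iv0 low EvEu IvIu J.
have pos36 : 0 < 36^-1 :> R by rewrite invr_gt0.
(* The lower bound makes both [Iv] and [Ev] positive. The product is then strictly increasing in the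
   second factor, so [Iv < Iu] would contradict the minimality of the larger product. *)
have prod0 := lt_le_trans pos36 low.
have Ivp : 0 < Iv.
  rewrite lt_neqAle Iv0 andbT; apply/eqP => Iv_eq0.
  by move: prod0; rewrite -Iv_eq0 expr0n mulr0 ltxx.
have Evp : 0 < Ev by move: prod0; rewrite pmulr_lgt0// exprn_gt0.
split=> //; apply/eqP; rewrite eq_le IvIu leNgt; apply/negP => lt.
have : Ev * Iv ^+ 3 < Eu * Iu ^+ 3.
  apply: (@lt_le_trans _ _ (Ev * Iu ^+ 3)).
    by rewrite ltr_pM2l// ltrXn2r.
  by rewrite ler_wpM2r// exprn_ge0// (le_trans Iv0).
by rewrite ltNge J.
Qed.

Lemma extremal_Qcurvature (R : realType) (u0 : R -> R) : extremal u0 ->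
  exists c : R, symmetric_Qcurvature u0 (cst c).
Proof.
move=> [[sob u_gt0 orth] umin].
have [peru cu _] := sob.
have [p [g upg]] := sobolev_triple sob.
have ve := even_triple upg; have cve := even_cont cu.
have v_gt0 := even_gt0 u_gt0.
have vadm := even_admissible upg cu u_gt0.
have EuEv : energy (even_part u0) (even_part p) (even_part g) <= energy u0 p g.
  by rewrite (energy_even_odd upg) lerDl; exact: energy_odd_ge0.
have low := energy_lower_bound ve cve v_gt0.
have := umin _ vadm; rewrite (functionalE upg) (functionalE ve) => J.
have [Ile Ieq] := even_powR_integral upg cu u_gt0.
have Iv0 : 0 <= itg 0 (2 * pi) (fun x => even_part u0 x `^ (- (2 / 3))).
  by apply: itg_ge0 => x _; exact: powR_ge0.
have [Ivp IE] := extremal_squeeze Iv0 low EuEv Ile J.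
have upi := Ieq IE.
(* Equality with the even part is needed only where the integrals look. The variational argument is
   run for the even part, which is [pi]-periodic on the whole line, and its equation is carried back
   to [u0] under the integral sign. *)
have uv x : 0 <= x <= 2 * pi -> u0 x = even_part u0 x.
  by move=> x2; rewrite /even_part upi//; field.
have vmin f : admissible f -> functional (even_part u0) <= functional f.
  move=> fadm; apply: le_trans (umin f fadm).
  rewrite (functionalE ve) (functionalE upg) -IE.
  by apply: ler_wpM2r => //; apply: exprn_ge0.
have vpi := even_pi upg.
have EL0 := euler_lagrange ve cve v_gt0 vpi vmin.
move: Ivp EL0 uv {ve cve v_gt0 vadm EuEv low J Ile Ieq Iv0 IE vmin vpi}.
move: (energy (even_part u0) _ _) (itg 0 (2 * pi) (fun x => even_part u0 x `^ (- (2 / 3)))).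
move: (even_part u0) => v Ev Iv Ivp EL0 uv.
pose lam := Ev / Iv.
pose s x := u0 x `^ (- (2 / 3)) / u0 x.
have [iu ip ig] := triple_intg upg.
have [_ w2] := triple_weak upg.
have is_ : intg 0 (2 * pi) s.
  apply: intg_continuous => x; apply: cvgM; first exact: cont_powR.
  by apply: cvgV; [rewrite gt_eqF|exact: cu].
have [[_ _ perg] _] := upg.
(* The equation [P u = lam * u ^ (- 5 / 3)] solved for the fourth derivative: it shows that the
   distribution is a function, and multiplication by [u ^ (5 / 3) / 9] leaves the constant
   [lam / 9]. *)
pose w x := (lam * s x - 10 * g x) - 9 * u0 x.
have iw : intg 0 (2 * pi) w.
  by apply: intgB; [apply: intgB|]; exact: intgZ.
have EL phi : test_function phi ->
    itg 0 (2 * pi) (fun x => u0 x * paneitz phi x) =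
    lam * itg 0 (2 * pi) (fun x => s x * phi x).
  move=> tphi; have H := EL0 _ tphi.
  have -> : itg 0 (2 * pi) (fun x => u0 x * paneitz phi x) =
      itg 0 (2 * pi) (fun x => v x * paneitz phi x).
    by apply: eq_itg => x x2; rewrite uv.
  have -> : itg 0 (2 * pi) (fun x => s x * phi x) =
      itg 0 (2 * pi) (fun x => v x `^ (- (2 / 3)) / v x * phi x).
    by apply: eq_itg => x x2; rewrite /s uv.
  apply: (@mulIf _ Iv); first by rewrite gt_eqF.
  by rewrite H /lam; move: (itg _ _ _) => D; field; rewrite gt_eqF.
exists (lam / 9); exists w.
  split=> // [x|phi tphi].
    by rewrite /w /s peru perg.
  have -> : (-1 : R) ^+ 4 = 1 by ring.
  rewrite mul1r.
  have P := (paneitz_intg tphi cu).2; have := EL _ tphi; rewrite P.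
  have [_ W2'] := triple_parts upg tphi; move: W2' {P}.
  move: (derive1n 4 phi) (derive1n 2 phi) => phi4 phi2 -> H.
  have is0 := intg_mul_test 0 is_ tphi; have ig0 := intg_mul_test 0 ig tphi.
  have iu0 := intg_mul_test 0 iu tphi.
  have -> : \int[lebesgue_measure]_(x in @circle R) (w x * phi x) =
      lam * itg 0 (2 * pi) (fun x => s x * phi x)
      - 10 * itg 0 (2 * pi) (fun x => g x * phi x)
      - 9 * itg 0 (2 * pi) (fun x => u0 x * phi x).
    rewrite -(itgZ lam is0) -(itgZ 10 ig0) -(itgZ 9 iu0).
    rewrite -itgB; [|exact: intgZ|exact: intgZ].
    rewrite -itgB; [|by apply: intgB; exact: intgZ|exact: intgZ].
    by apply: eq_itg => x _; rewrite /w /=; ring.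
  rewrite -H -[LHS]/(itg 0 (2 * pi) (fun x => u0 x * phi4 x)).
  by ring.
have e2 := weak_unique (weak_derivativeP w2) w2.
apply: (@filterS _ _ (ae_filter_ringOfSetsType lebesgue_measure) _ _ _ e2) => x H cx.
rewrite /= /cst H// /w /s.
have ux : u0 x != 0 by rewrite gt_eqF.
have -> : u0 x `^ (- (2 / 3)) = u0 x / u0 x `^ (5 / 3).
  rewrite -{2}[u0 x]powRr1; last exact: ltW.
  rewrite -powRB ?ux ?implybT//.
  by congr (_ `^ _); field.
by field; rewrite ux gt_eqF// powR_gt0.
Qed.

Theorem theorem3 (R : realType) :
  (exists C0 : R, 0 < C0 /\
     forall u : R -> R, admissible u -> C0 <= functional u) /\
  (forall u0 : R -> R, extremal u0 ->
     exists c : R, symmetric_Qcurvature u0 (cst c)).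
Proof.
split; last exact: extremal_Qcurvature.
exists 36^-1; split; first by rewrite invr_gt0.
exact: functional_lower_bound.
Qed.
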